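(* Let $k$ be a field of prime characteristic $p$, let $r$ be a positive integer and let $\lambda$ be a partition of $r$. Then: (a) If $p$ is odd, then $M^\lambda$ is indecomposable if, and only if, one of the following holds: - $p$ divides $r$ and $\lambda$ is equal to $(r)$ or $(r-1,1)$; - $p$ does not divide $r$ and $\lambda=(r)$. (b) If $p=2$, then $M^\lambda$ is indecomposable if, and only if, one of the following holds: - $r$ is odd and $\lambda=(r)$; - $r$ is even and $\lambda=(r)$ or $\lambda$ is one of the $n$ partitions $(r-k_i,k_i)$, $1\le i\le n$, where $2^{n}\leq r<2^{n+1}$, and for each $1\leq i\leq n$ the non-negative integer $k_i$ is such that $2^{i-1}\leq k_i<2^{i}$ and $k_i\equiv \frac{r-2^n}{2} \pmod{2^{i-1}}$. Furthermore, if either (i) $p$ is odd, but $p$ and $r$ are not both $3$, or (ii) $p=2$ and $r$ is odd, then $M^\lambda$ is decomposable if, and only if, it has direct summands lying outside of the principal block of $k\mathcal{S}_r$. If $p=2$ and $r$ is even, then $M^\lambda$ has direct summands lying outside of the principal block of $k\mathcal{S}_r$ if, and only if, $\lambda$ has at least $3$ parts, $r\geq 6$ and $\lambda\neq (r-2,1,1)$.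
   Context: $\mathcal{S}_r$ is the symmetric group on $r$ letters. For a partition $\lambda$ of $r$, $M^\lambda$ is the Young permutation module: the permutation $k\mathcal{S}_r$-module with basis the set of all $\lambda$-tabloids, equivalently the permutation module on the cosets of the Young subgroup $\mathcal{S}_\lambda=\mathcal{S}_{\lambda_1}\times\mathcal{S}_{\lambda_2}\times\cdots$. The principal block of $k\mathcal{S}_r$ is the block containing the trivial module. The number of parts of $\lambda$ means the number of non-zero parts. *)

(* Defs.v *)
From HB Require Import structures.
From mathcomp Require Import all_boot all_order all_fingroup all_algebra.
From mathcomp Require Import mxrepresentation.

Set Implicit Arguments.
Unset Strict Implicit.
Unset Printing Implicit Defensive.

Import GroupScope GRing.Theory.
Local Open Scope ring_scope.

(* Partitions carry no trailing zeros, so the number of parts is [size lam]. *)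
Definition is_partition (r : nat) (lam : seq nat) : bool :=
  [&& sorted geq lam, all (leq 1) lam & sumn lam == r].

Section Tabloids.
Variables (r : nat) (lam : seq nat).

(* A tabloid is a filling of the diagram by 0, ..., r-1 up to reordering within
   rows, i.e. the function sending each entry to the index of its row. *)
Definition is_tabloid (t : {ffun 'I_r -> 'I_(size lam)}) : bool :=
  [forall i, #|[set x | t x == i]| == nth 0%N lam i].

Definition tabloid := {t : {ffun 'I_r -> 'I_(size lam)} | is_tabloid t}.

(* Permutations multiply left to right, (s * s') x = s' (s x), so replacing
   each entry x by s x is a right action. *)
Definition tabloid_fact (t : {ffun 'I_r -> 'I_(size lam)}) (s : 'S_r) :
  {ffun 'I_r -> 'I_(size lam)} := [ffun x => t (s^-1%g x)].

Lemma tabloid_actP (t : tabloid) (s : 'S_r) :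
  is_tabloid (tabloid_fact (val t) s).
Proof.
apply/forallP=> i; have /forallP/(_ i)/eqP <- := valP t; apply/eqP.
rewrite -[RHS](card_imset _ (@perm_inj _ s)); apply: eq_card => x.
rewrite inE /tabloid_fact ffunE; apply/idP/imsetP => [tx|[y + ->]].
  by exists (s^-1%g x); rewrite ?inE // permKV.
by rewrite inE permK.
Qed.

Definition tabloid_act (t : tabloid) (s : 'S_r) : tabloid :=
  Sub (tabloid_fact (val t) s) (tabloid_actP t s).

Lemma tabloid_act1 : tabloid_act^~ 1%g =1 id.
Proof.
move=> t; apply/val_inj/ffunP=> x.
by rewrite /= /tabloid_fact ffunE invg1 perm1.
Qed.

Lemma tabloid_actM t : act_morph tabloid_act t.
Proof.
move=> s s'; apply/val_inj/ffunP=> x.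
by rewrite /= /tabloid_fact !ffunE invMg permM.
Qed.

Definition tabloid_action := TotalAction tabloid_act1 tabloid_actM.

End Tabloids.

Section PermutationModule.
Variables (F : fieldType) (gT : finGroupType) (T : finType).
Variable to : {action gT &-> T}.

Definition act_mx (g : gT) : 'M[F]_#|T| :=
  \matrix_(i, j) (to (enum_val i) g == enum_val j)%:R.

Lemma act_mx_repr : mx_repr [set: gT] act_mx.
Proof.
split=> [|g h _ _].
  by apply/matrixP=> i j; rewrite !mxE act1 (inj_eq enum_val_inj).
apply/matrixP=> i j; rewrite !mxE actM.
rewrite (bigD1 (enum_rank (to (enum_val i) g))) //= !mxE enum_rankK eqxx mul1r.
rewrite big1 ?addr0 // => l nel; rewrite !mxE.
case: eqP => [e|]; last by rewrite mul0r.
by rewrite e enum_valK eqxx in nel.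
Qed.

Definition perm_repr := MxRepresentation act_mx_repr.

End PermutationModule.

Definition young_perm_repr (F : fieldType) (r : nat) (lam : seq nat) :
  mx_representation F [set: 'S_r] #|{: tabloid r lam}| :=
  perm_repr F (tabloid_action r lam).

Section Modules.
Variables (F : fieldType) (gT : finGroupType) (G : {group gT}).

Lemma triv_mx_repr : mx_repr G (fun _ : gT => 1%:M : 'M[F]_1).
Proof. by split=> // x y _ _; rewrite mulmx1. Qed.

Definition triv_repr := MxRepresentation triv_mx_repr.

Section Summands.
Variables (n : nat) (rG : mx_representation F G n).

Definition direct_sum (M U V : 'M[F]_n) : Prop :=
  [/\ mxmodule rG U, mxmodule rG V, (U + V :=: M)%MS & mxdirect (U + V)].

Definition decomposable (M : 'M[F]_n) : Prop :=
  exists U V : 'M[F]_n, [/\ U != 0, V != 0 & direct_sum M U V].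

Definition indecomposable (M : 'M[F]_n) : Prop :=
  M != 0 /\ ~ decomposable M.

Definition direct_summand (M U : 'M[F]_n) : Prop :=
  exists V : 'M[F]_n, direct_sum M U V.

End Summands.

Definition central_idempotent (e : 'M[F]_#|G|) : Prop :=
  (e \in 'Z(group_ring F G))%MS /\ e *m e = e.

(* Blocks are identified with the primitive central idempotents of FG, seen as
   matrices of the regular representation. *)
Definition is_block (e : 'M[F]_#|G|) : Prop :=
  [/\ central_idempotent e, e != 0
    & forall e1 e2, central_idempotent e1 -> central_idempotent e2 ->
        e1 *m e2 = 0 -> e = e1 + e2 -> e1 = 0 \/ e2 = 0].

Definition lies_in_block n (rG : mx_representation F G n) (e : 'M[F]_#|G|)
  (U : 'M[F]_n) : Prop := U *m gring_op rG e = U.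

Definition is_principal_block (e : 'M[F]_#|G|) : Prop :=
  is_block e /\ lies_in_block triv_repr e 1%:M.

Definition has_nonprincipal_summand n (rG : mx_representation F G n) : Prop :=
  exists (U : 'M[F]_n) (e : 'M[F]_#|G|),
    [/\ direct_summand rG 1%:M U, indecomposable rG U, is_block e,
        ~ is_principal_block e & lies_in_block rG e U].

End Modules.

(* Main.v *)
Require Import Defs.
From Stdlib Require Import Classical.
From mathcomp Require Import all_boot all_order all_fingroup all_algebra.
From mathcomp Require Import mxrepresentation ring zify.

(** Everything is read off from explicit eigenvectors and from the endomorphism
    algebras of a few permutation modules.

    Summands outside the principal block. The element y, the sum of (s - 1) over all
    transpositions s, is central and kills the trivial module, so it acts
    nilpotently on whatever lies in the principal block. Hence a nonzero eigenvalue
    of y on [M^lam] produces a summand in another block ([nonprincipal_of_eigen]).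
    By Young's column antisymmetrizer, every tableau of shape mu that is compatible
    with some tabloid yields an eigenvector of y ([antisymmetrize_eigen]), whose
    eigenvalue is the difference of the content sums of mu and (r): it is -r for
    (r-1,1), 2-2r for (r-2,2) and 3-3r for (r-3,2,1). The first shape settles every
    r prime to p, the second every odd p dividing r, and the third even r in
    characteristic 2. What is not below the relevant shape is (r), or (r-1,1), or for
    p = 2 has two parts or is (r-2,1,1), apart from a few partitions of r at most 4. A
    permutation module has a nonzero fixed vector, so it is decomposable as soon as it
    has a summand outside the principal block ([nonprincipal_decomposable]).

    Two parts in characteristic 2. The module of (r-k,k) is spanned by the k-subsets
    of the r letters, and an endomorphism is a function f of the size of the
    intersection, that is, a combination over m of the maps N_m that factor through
    the m-subsets ([newton_interpolation]). For l at most k the indicator function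
    of the k-sets that meet each of l fixed disjoint pairs exactly once is an
    eigenvector of every N_m, with a product of two binomial coefficients as
    eigenvalue ([transversal_eigen_inclusion]). These eigenvalues decide everything
    ([up_eigen]): an idempotent f none of whose eigenvalues is 1 must vanish
    ([idem_kernel_zero]). If 2^i divides r - 2k, where 2^i is the least power of 2
    above k, all N_m with m < k have eigenvalues 0, so 0 and 1 are the only
    idempotents; otherwise some N_m has both eigenvalues 0 and 1, and
    Fitting's lemma decomposes the module ([decomposable_eigen]).

    Only the principal block. For even r a block idempotent that kills the trivial
    module kills all k-sets with k at most r/2, by induction on k: its eigenvalues
    on transversals to k and to k - 1 pairs agree, and the latter is inherited from
    the (k-1)-sets ([set_kernel_zero]). Splitting a part 2 into 1 + 1 preserves
    this vanishing in characteristic 2 ([merge_kernel_zero]), which covers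
    (r-2,1,1) and (1,1,1,1). These last partitions and (1,1,1) for p = 3 are
    decomposed by hand. *)

Set Implicit Arguments.
Unset Strict Implicit.
Unset Printing Implicit Defensive.
Import GRing.Theory.
Local Open Scope ring_scope.

(** * Idempotents, decompositions and blocks *)

Section Fitting.
Variable F : fieldType.

(** Split off from ['X * P] the power ['X ^+ m] and take for [a] the multiple of
    ['X ^+ m] in a Bezout relation with the other factor. The extra ['X] makes [a]
    vanish at 0 whether or not 0 is a root of [P]. *)
Lemma fitting_poly (P : {poly F}) : P != 0 ->
  exists a : {poly F},
    [/\ P %| a * a - a, a.[0] = 0 & forall c, c != 0 -> root P c -> a.[c] = 1].
Proof.
move=> P0; have [m [q nq0 PE]] := multiplicity_XsubC ('X * P) 0.
have nq : ~~ root q 0 by move: nq0; rewrite mulf_neq0 ?polyX_eq0.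
rewrite subr0 in PE.
have m0 : (0 < m)%N.
  case: m PE => // PE; move: nq; rewrite expr0 mulr1 in PE.
  by rewrite -PE rootM rootX eqxx.
have cop : coprimep ('X ^+ m) q.
  by apply: coprimep_expl; rewrite coprimep_sym -['X]subr0 -polyC0 coprimep_XsubC.
have [[u v] /= uv1] := Bezout_eq1_coprimepP _ _ cop.
exists (u * 'X ^+ m); split.
- have -> : (u * 'X ^+ m) * (u * 'X ^+ m) - u * 'X ^+ m = - (u * v * 'X) * P.
    rewrite mulNr -!mulrA PE -{3}[u]mulr1 -{1}uv1; ring.
  exact: dvdp_mulIr.
- by rewrite hornerM hornerXn expr0n gtn_eqF // mulr0.
move=> c c0 Pc; have qc : q.[c] = 0.
  have: ('X * P).[c] = 0 by rewrite hornerM (rootP Pc) mulr0.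
  rewrite PE hornerM hornerXn => /eqP; rewrite mulf_eq0 expf_eq0 (negPf c0).
  by rewrite andbF orbF => /eqP.
have := congr1 (horner^~ c) uv1; rewrite hornerD !hornerM qc mulr0 addr0 => ->.
by rewrite hornerC.
Qed.

(** The evaluation [horner_mx] is defined only for sizes that are successors, those
    for which the square matrices form a nontrivial ring. *)
Definition hmx n : 'M[F]_n -> {poly F} -> 'M[F]_n :=
  if n is n'.+1 then fun A p => horner_mx A p else fun _ _ => 0.

Lemma hmxD n (A : 'M[F]_n) p q : hmx A (p + q) = hmx A p + hmx A q.
Proof. by case: n A => [|n] A; rewrite /= ?addr0 ?rmorphD. Qed.

Lemma hmxB n (A : 'M[F]_n) p q : hmx A (p - q) = hmx A p - hmx A q.
Proof. by case: n A => [|n] A; rewrite /= ?subr0 ?rmorphB. Qed.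

Lemma hmxM n (A : 'M[F]_n) p q : hmx A (p * q) = hmx A p *m hmx A q.
Proof. by case: n A => [|n] A; rewrite /= ?mul0mx ?rmorphM. Qed.

Lemma hmxX n (A : 'M[F]_n) : hmx A 'X = A.
Proof. by case: n A => [|n] A; rewrite /= ?horner_mx_X ?[A]thinmx0. Qed.

Lemma hmxC n (A : 'M[F]_n) a : hmx A a%:P = a%:M.
Proof. by case: n A => [|n] A; rewrite /= ?horner_mx_C ?[_%:M]thinmx0. Qed.

Lemma row_hmx n (A : 'M[F]_n) (w : 'rV_n) c p :
  w *m A = c *: w -> w *m hmx A p = p.[c] *: w.
Proof.
move=> wA; elim/poly_ind: p => [|p a IH].
  by rewrite -polyC0 hmxC polyC0 horner0 mul_mx_scalar.
rewrite hmxD hmxM hmxX hmxC.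
by rewrite !hornerE mulmxDr mul_mx_scalar mulmxA IH -scalemxAl wA scalerA scalerDl.
Qed.

Lemma exists_annihilator n (A : 'M[F]_n) :
  exists2 P : {poly F}, P != 0 & hmx A P = 0.
Proof.
exists (char_poly A); first exact: monic_neq0 (char_poly_monic A).
by case: n A => // n A; apply: Cayley_Hamilton.
Qed.

Lemma hmx_idem n (A : 'M[F]_n) (P a : {poly F}) :
  P %| a * a - a -> hmx A P = 0 -> hmx A a *m hmx A a = hmx A a.
Proof.
move=> /dvdpP[q aE] AP; apply/eqP; rewrite -subr_eq0 -hmxM -hmxB aE hmxM AP.
by rewrite mulmx0.
Qed.

End Fitting.

Section Decomposition.
Variables (F : fieldType) (gT : finGroupType) (G : {group gT}).
Variables (n : nat) (rG : mx_representation F G n).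

Lemma direct_sum_idem (E : 'M[F]_n) :
  centgmx rG E -> E *m E = E -> direct_sum rG 1%:M E (1%:M - E).
Proof.
move=> /centgmxP cE EE.
have modE (A : 'M_n) : (forall x, x \in G -> A *m rG x = rG x *m A) -> mxmodule rG A.
  by move=> cA; apply/mxmoduleP=> x Gx; rewrite cA // submxMl.
split.
- exact: modE.
- by apply: modE => x Gx; rewrite mulmxBl mulmxBr cE // mul1mx mulmx1.
- apply/eqmxP; rewrite submx1 /=.
  have {1}-> : 1%:M = E + (1%:M - E) by rewrite addrC subrK.
  by rewrite addmx_sub_adds.
apply/mxdirect_addsP/eqP/rowV0P=> v; rewrite sub_capmx => /andP[].
move=> /submxP[a va] /submxP[b vb].
have vE : v *m E = v by rewrite va -mulmxA EE.
by rewrite -vE vb -mulmxA mulmxBl mul1mx EE subrr mulmx0.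
Qed.

Lemma decomposable_idem (E : 'M[F]_n) :
  centgmx rG E -> E *m E = E -> E != 0 -> E != 1%:M -> decomposable rG 1%:M.
Proof.
move=> cE EE E0 E1; exists E, (1%:M - E); split=> //; last exact: direct_sum_idem.
by rewrite subr_eq0 eq_sym.
Qed.

Lemma idem_of_decomposable : decomposable rG 1%:M ->
  exists E : 'M[F]_n, [/\ centgmx rG E, E *m E = E, E != 0 & E != 1%:M].
Proof.
case=> U [V [U0 V0 [mU mV UV /mxdirect_addsP dUV]]].
have dVU : (V :&: U = 0)%MS by rewrite capmxC.
set E := proj_mx U V; exists E; split.
- rewrite -row_full_dom_hom -sub1mx -UV; exact: proj_mx_hom.
- exact: proj_mx_proj.
- by apply: contraNneq U0 => E0; rewrite -(proj_mx_id dUV (submx_refl U)) -/E E0 mulmx0.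
by apply: contraNneq V0 => E1; rewrite -[V]mulmx1 -E1 (proj_mx_0 dUV).
Qed.

(** The polynomial of [fitting_poly] for an annihilator of [theta] is 0 at 0 and 1
    at [c]; at [theta] it is the projection of Fitting's lemma, which kills [w0] and
    fixes [w1]. *)
Lemma decomposable_eigen (theta : 'M[F]_n) (w0 w1 : 'rV_n) c :
  centgmx rG theta -> w0 != 0 -> w0 *m theta = 0 ->
  w1 != 0 -> c != 0 -> w1 *m theta = c *: w1 -> decomposable rG 1%:M.
Proof.
move=> cth w00 w0th w10 c0 w1th.
have [P P0 PA] := exists_annihilator theta.
have [a [Pa a0 a1]] := fitting_poly P0.
have rPc : root P c.
  have := row_hmx P w1th; rewrite PA mulmx0 => /esym/eqP.
  by rewrite scaler_eq0 (negPf w10) orbF.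
have w0E : w0 *m hmx theta a = 0.
  by rewrite (@row_hmx _ _ _ _ 0) ?scale0r // a0 scale0r.
have w1E : w1 *m hmx theta a = w1.
  by rewrite (row_hmx _ w1th) a1 ?scale1r.
apply: (@decomposable_idem (hmx theta a)).
- apply/centgmxP=> x Gx; elim/poly_ind: (a) => [|p b IH].
    by rewrite -polyC0 hmxC scalar_mxC.
  rewrite hmxD hmxM hmxX hmxC mulmxDl mulmxDr scalar_mxC; congr (_ + _).
  by rewrite -mulmxA (centgmxP cth) // !mulmxA IH.
- exact: hmx_idem PA.
- by apply: contraNneq w10 => E0; rewrite -w1E E0 mulmx0.
by apply: contraNneq w00 => E1; rewrite -[w0]mulmx1 -E1 w0E.
Qed.

End Decomposition.

Section Blocks.
Variables (F : fieldType) (gT : finGroupType) (G : {group gT}).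
Local Notation ZG := ('Z(group_ring F G))%MS.

(** Elements of the group algebra commute with module homomorphisms; this is how
    the action of a block idempotent is carried from one module to another. *)
Lemma gring_op_intertwine n n' (rG : mx_representation F G n)
    (rG' : mx_representation F G n') (P : 'M_(n, n')) a :
  {in G, forall x, rG x *m P = P *m rG' x} ->
  gring_op rG a *m P = P *m gring_op rG' a.
Proof.
move=> rP.
have opE m (rH : mx_representation F G m) : gring_op rH a =
    \sum_(i < #|G|) gring_row a 0 i *: rH (enum_val i).
  rewrite gring_opE /gring_mx /= mulmx_sum_row linear_sum.
  by apply: eq_bigr => i _; rewrite rowK linearZ /= mxvecK.
rewrite !opE mulmx_suml mulmx_sumr; apply: eq_bigr => i _.
by rewrite -scalemxAl -scalemxAr rP ?enum_valP.
Qed.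

Section Rep.
Variables (n : nat) (rG : mx_representation F G n).

Lemma gring_op_center z : (z \in ZG)%MS -> centgmx rG (gring_op rG z).
Proof.
move=> /center_mxP[Rz cz]; apply/centgmxP=> x Gx.
have Rx : (regular_repr F G x \in group_ring F G)%MS by apply: envelop_mx_id.
by rewrite -(gring_opG rG Gx) -!gring_opM // cz.
Qed.

Lemma central_mul z z' :
  (z \in ZG)%MS -> (z' \in ZG)%MS -> (z *m z' \in ZG)%MS.
Proof.
move=> /center_mxP[Rz cz] /center_mxP[Rz' cz']; apply/center_mxP; split.
  exact: envelop_mxM.
by move=> B RB; rewrite mulmxA cz // -mulmxA cz' // mulmxA.
Qed.

Lemma central_scalar c : (c%:M \in ZG)%MS.
Proof.
apply/center_mxP; split=> [|B _]; last exact: scalar_mxC.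
by rewrite -scalemx1 linearZ scalemx_sub ?envelop_mx1.
Qed.

Lemma central_add z z' :
  (z \in ZG)%MS -> (z' \in ZG)%MS -> (z + z' \in ZG)%MS.
Proof. by move=> Zz Zz'; rewrite linearD addmx_sub. Qed.

Lemma central_hmx z p : (z \in ZG)%MS -> (hmx z p \in ZG)%MS.
Proof.
move=> Zz; elim/poly_ind: p => [|p a IH]; first by rewrite -polyC0 hmxC central_scalar.
rewrite hmxD hmxM hmxX hmxC.
by rewrite central_add ?central_scalar // central_mul.
Qed.

Lemma gring_op_hmx z p : (z \in ZG)%MS ->
  gring_op rG (hmx z p) = hmx (gring_op rG z) p.
Proof.
move=> Zz; have /center_mxP[Rz _] := Zz.
elim/poly_ind: p => [|p a IH]; last first.
  rewrite !hmxD !hmxM !hmxX !hmxC linearD /= gring_opM // IH; congr (_ + _).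
  by rewrite -scalemx1 linearZ /= gring_op1 scalemx1.
by rewrite -polyC0 !hmxC !rmorph0 linear0.
Qed.

Lemma central_idem_op e : central_idempotent e ->
  gring_op rG e *m gring_op rG e = gring_op rG e.
Proof. by move=> [/center_mxP[Re _] ee]; rewrite -gring_opM // ee. Qed.

End Rep.

Lemma ex_min_nat (T : Type) (P : T -> Prop) (m : T -> nat) :
  (exists x, P x) -> exists2 x, P x & forall y, P y -> (m x <= m y)%N.
Proof.
case=> x; have [k] := ubnP (m x); elim: k x => // k IH x lk Px.
have [[y [Py lt]]|no] := classic (exists y, P y /\ (m y < m x)%N).
  by apply: IH Py; apply: leq_trans lt _; rewrite -ltnS.
exists x => // y Py; rewrite leqNgt; apply/negP=> lt; case: no.
by exists y.
Qed.

Section Summand.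
Variables (n : nat) (rG : mx_representation F G n).

Lemma rank_orthogonal_idem m (e1 e2 : 'M[F]_m) :
  e1 *m e1 = e1 -> e2 *m e2 = e2 -> e1 *m e2 = 0 -> e2 *m e1 = 0 ->
  \rank (e1 + e2)%R = (\rank e1 + \rank e2)%N.
Proof.
move=> e11 e22 e12 e21.
have -> : \rank (e1 + e2)%R = \rank (e1 + e2)%MS.
  apply/eqP; rewrite eqn_leq !mxrankS //; last exact: addmx_sub_adds.
  have s1 : e1 = e1 *m (e1 + e2)%R by rewrite mulmxDr e11 e12 addr0.
  have s2 : e2 = e2 *m (e1 + e2)%R by rewrite mulmxDr e21 e22 add0r.
  by rewrite addsmx_sub; apply/andP; split; [rewrite {1}s1|rewrite {1}s2]; apply: submxMl.
apply/mxdirectP/mxdirect_addsP/eqP/rowV0P=> v; rewrite sub_capmx => /andP[].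
move=> /submxP[a va] /submxP[b vb].
have vE : v *m e1 = v by rewrite va -mulmxA e11.
by rewrite -vE vb -mulmxA e21 mulmx0.
Qed.

(** A central idempotent of minimal rank among those that kill the trivial module
    but not [rG] is primitive, and it cuts out a nonzero summand, from which an
    indecomposable one is split off by minimality again. *)
Lemma nonprincipal_of_idem f : central_idempotent f ->
  gring_op (triv_repr F G) f = 0 -> gring_op rG f != 0 ->
  has_nonprincipal_summand rG.
Proof.
move=> If tf rf.
pose good (e : 'M[F]_#|G|) := [/\ central_idempotent e,
  gring_op (triv_repr F G) e = 0 & gring_op rG e != 0].
have [|e [Ie te re] emin] := @ex_min_nat _ good (fun e => \rank e).
  by exists f.
have [Ze ee] := Ie.
pose summ (U : 'M[F]_n) := [/\ direct_summand rG 1%:M U, U != 0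
  & lies_in_block rG e U].
have [|U [[V UV] U0 Ue] Umin] := @ex_min_nat _ summ (fun e => \rank e).
  exists (gring_op rG e); split=> //; last exact: central_idem_op.
  exists (1%:M - gring_op rG e); apply: direct_sum_idem.
    exact: gring_op_center.
  exact: central_idem_op.
(* Conditions in order: summand, indecomposable, block, not principal, lying in it. *)
exists U, e; split=> //.
- by exists V.
- split=> // -[U1 [U2 [U10 U20 [mU1 mU2 U12 /mxdirectP /= dU12]]]].
  have [mU mV UV1 /mxdirectP /= dUV] := UV.
  have rU : \rank U = (\rank U1 + \rank U2)%N by rewrite -U12 dU12.
  have sU1 : (U1 <= U)%MS by rewrite -U12 addsmxSl.
  suff: (\rank U <= \rank U1)%N.
    by rewrite rU -{2}[\rank U1]addn0 leq_add2l leqn0 mxrank_eq0 (negPf U20).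
  apply: Umin; split=> //; last first.
    by have /submxP[D ->] := sU1; rewrite /lies_in_block -mulmxA Ue.
  have eqS : (U1 + (U2 + V) :=: 1%:M)%MS.
    rewrite addsmxA; apply: eqmx_trans UV1; exact: adds_eqmx.
  exists (U2 + V)%MS; split=> //; first exact: addsmx_module.
  apply/mxdirectP => /=; apply/eqP; rewrite eqn_leq; apply/andP; split.
    by rewrite mxrank_adds_leqif.
  rewrite eqS -UV1 dUV rU -addnA leq_add2l.
  by rewrite mxrank_adds_leqif.
- split=> //; first by apply: contraNneq re => ->; rewrite linear0.
  move=> e1 e2 [Z1 e11] [Z2 e22] e12 edef.
  have [[R1 c1] [R2 c2]] := (center_mxP Z1, center_mxP Z2).
  have e21 : e2 *m e1 = 0 by rewrite c1.
  have rk : \rank e = (\rank e1 + \rank e2)%N by rewrite edef rank_orthogonal_idem.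
  have small e' : (e' \in ZG)%MS -> e' *m e' = e' -> e *m e' = e' ->
      gring_op rG e' != 0 -> (\rank e <= \rank e')%N.
    move=> Ze' ee' ee'' re'; apply: emin; split=> //.
    by rewrite -ee'' gring_opM ?te ?mul0mx //; case/center_mxP: Ze'.
  have [r1|r1] := eqVneq (gring_op rG e1) 0.
    left; apply/eqP; rewrite -mxrank_eq0 -leqn0 -(leq_add2r (\rank e2)) -rk.
    apply: small => //; first by rewrite edef mulmxDl e12 e22 add0r.
    by apply: contraNneq re => r2; rewrite edef linearD /= r1 r2 addr0.
  right; apply/eqP; rewrite -mxrank_eq0 -leqn0 -(leq_add2l (\rank e1)) -rk addn0.
  by apply: small => //; rewrite edef mulmxDl e11 e21 addr0.
- case=> _; rewrite /lies_in_block te mulmx0 => /eqP.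
  by rewrite eq_sym oner_eq0.
Qed.

(** The idempotent of [fitting_poly] evaluated at [y] is the central idempotent
    on whose part [y] is invertible: it kills the trivial module and fixes [w]. *)
Lemma nonprincipal_of_eigen y (w : 'rV_n) c : (y \in ZG)%MS ->
  gring_op (triv_repr F G) y = 0 -> w != 0 -> c != 0 ->
  w *m gring_op rG y = c *: w -> has_nonprincipal_summand rG.
Proof.
move=> Zy ty w0 c0 wy.
have [P P0 PA] := exists_annihilator y.
have [a [Pa a0 a1]] := fitting_poly P0.
have rPc : root P c.
  have := row_hmx P wy; rewrite -gring_op_hmx // PA linear0 mulmx0.
  by move/esym/eqP; rewrite scaler_eq0 (negPf w0) orbF.
apply: (@nonprincipal_of_idem (hmx y a)).
- split; first exact: central_hmx.
  exact: hmx_idem PA.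
- rewrite gring_op_hmx // ty.
  have /(_ 1%:M 0) := @row_hmx _ _ (0 : 'M[F]_1) _ _ a.
  by rewrite mulmx0 scale0r mul1mx => ->; rewrite ?a0 ?scale0r.
apply: contraNneq w0 => E0; have := row_hmx a wy.
by rewrite a1 // scale1r -gring_op_hmx // E0 mulmx0 => <-.
Qed.

(** An idempotent acts on the one-dimensional trivial module as 0 or 1. *)
Lemma nonprincipal_idem : has_nonprincipal_summand rG ->
  exists e, [/\ central_idempotent e, gring_op (triv_repr F G) e = 0
    & gring_op rG e != 0].
Proof.
case=> U [e [_ [U0 _] Be nPe Ue]]; have [Ie _ _] := Be; exists e; split=> //.
  have tt := central_idem_op (triv_repr F G) Ie.
  have [//|t0] := eqVneq (gring_op (triv_repr F G) e) 0; case: nPe; split=> //.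
  rewrite /lies_in_block mul1mx; move: tt t0.
  rewrite [gring_op _ e]mx11_scalar; move: (_ 0 0) => c.
  rewrite -scalar_mxM => /(congr1 (fun A : 'M_1 => A 0 0)); rewrite !mxE !mulr1n.
  have [->|c0 cc _] := eqVneq c 0; first by rewrite raddf0 eqxx.
  by rewrite (mulfI c0 (etrans cc (esym (mulr1 c)))).
by apply: contraNneq U0 => e0; rewrite -Ue e0 mulmx0.
Qed.

(** A nonzero fixed vector forbids [rG] from lying entirely in a nonprincipal
    block, so a nonprincipal summand is a proper one. *)
Lemma nonprincipal_decomposable (j : 'rV_n) : j != 0 ->
  {in G, forall x, j *m rG x = j} ->
  has_nonprincipal_summand rG -> decomposable rG 1%:M.
Proof.
move=> j0 jG /nonprincipal_idem[e [Ie te re]].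
apply: (@decomposable_idem _ _ _ _ rG (gring_op rG e)) => //.
- by apply: gring_op_center; case: Ie.
- exact: central_idem_op.
apply: contraNneq j0 => e1; rewrite -[j]mulmx1 -e1.
rewrite -(@gring_op_intertwine _ _ (triv_repr F G) rG j) ?te ?mul0mx //.
by move=> x Gx; rewrite mul1mx jG.
Qed.

End Summand.
End Blocks.

(** * Sets up to permutation *)

Section Fibers.

Lemma perm_of_fibers r (X : eqType) (c c' : 'I_r -> X) :
  (forall v, #|[pred x | c x == v]| = #|[pred x | c' x == v]|) ->
  exists s : 'S_r, forall x, c' (s x) = c x.
Proof.
move=> cc'; pose t := [tuple c x | x < r]; pose t' := [tuple c' x | x < r].
have: perm_eq t t'.
  apply/allP=> v _; have := cc' v; rewrite !cardE !size_filter /= !count_map.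
  by move=> e; apply/eqP; exact: e.
case/tuple_permP=> s /val_inj/(congr1 (fun u => tnth u _)) ts; exists s => x.
by have := ts x; rewrite !tnth_mktuple.
Qed.

Lemma set_pair_transitive r (S1 S2 R1 R2 : {set 'I_r}) :
  #|S1| = #|R1| -> #|S2| = #|R2| -> #|S1 :&: S2| = #|R1 :&: R2| ->
  exists s : 'S_r, s @: S1 = R1 /\ s @: S2 = R2.
Proof.
move=> e1 e2 e12.
have [|s sP] := @perm_of_fibers r _ (fun x => (x \in S1, x \in S2))
  (fun x => (x \in R1, x \in R2)); last first.
  have im (A B : {set 'I_r}) : (forall x, (s x \in B) = (x \in A)) -> s @: A = B.
    move=> AB; apply/setP=> y; rewrite -[y](permKV s) mem_imset ?AB //.
    exact: perm_inj.
  by exists s; split; apply: im => x; case: (sP x).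
have key (A B : {set 'I_r}) v : #|[pred x | (x \in A, x \in B) == v]| =
    match v with (true, true) => #|A :&: B| | (true, false) => #|A| - #|A :&: B|
    | (false, true) => #|B| - #|A :&: B|
    | (false, false) => r - (#|A| + #|B| - #|A :&: B|) end%N.
  case: v => [[] []].
  - by apply: eq_card => x; rewrite !inE; case: (x \in A); case: (x \in B).
  - rewrite -cardsD; apply: eq_card => x; rewrite !inE.
    by case: (x \in A); case: (x \in B).
  - rewrite setIC -cardsD; apply: eq_card => x; rewrite !inE.
    by case: (x \in A); case: (x \in B).
  have -> : (r - (#|A| + #|B| - #|A :&: B|))%N = #|~: (A :|: B)|.
    by rewrite [RHS]cardsCs setCK card_ord cardsU.
  apply: eq_card => x; rewrite !inE.
  by case: (x \in A); case: (x \in B).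
by move=> v; rewrite !key e1 e2 e12.
Qed.

(** Hence the homomorphisms between the modules of [l]-sets and of [k]-sets are the
    functions of the size of the intersection. *)
Lemma invariant_set_kernel r (Y : Type) (y0 : Y) (A : {set 'I_r} -> {set 'I_r} -> Y) l k :
  (forall (s : 'S_r) (R S : {set 'I_r}), A (s @: R) (s @: S) = A R S) ->
  exists h : nat -> Y,
    forall R S : {set 'I_r}, #|R| = l -> #|S| = k -> A R S = h #|R :&: S|.
Proof.
move=> Ainv; exists (fun x => if [pick p : {set 'I_r} * {set 'I_r} |
    [&& #|p.1| == l, #|p.2| == k & #|p.1 :&: p.2| == x]] is Some p
  then A p.1 p.2 else y0).
move=> R S Rl Sk; case: pickP => [[R' S'] /= /and3P[/eqP R'l /eqP S'k /eqP RS]|].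
  have [||//|s [<- <-]] := @set_pair_transitive r R' S' R S; rewrite ?Rl ?Sk //.
by move/(_ (R, S)); rewrite /= Rl Sk !eqxx.
Qed.

(** ['C(#|R :&: S|, m)] counts the [m]-subsets of [R :&: S], so in this form a
    function of [#|R :&: S|] is a combination of maps that factor through the modules
    of [m]-sets. *)
Lemma newton_interpolation (F : fieldType) (f : nat -> F) n :
  exists b : nat -> F, forall x, (x <= n)%N ->
    f x = \sum_(m < n.+1) b m * 'C(x, m)%:R.
Proof.
elim: n => [|n [b IH]].
  exists f => x; rewrite leqn0 => /eqP->.
  by rewrite big_ord1 bin0 mulr1.
exists (fun m => if m == n.+1
  then f n.+1 - \sum_(m < n.+1) b m * 'C(n.+1, m)%:R else b m) => x.
have eqb y : \sum_(m < n.+1) (if (m : nat) == n.+1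
    then f n.+1 - \sum_(m < n.+1) b m * 'C(n.+1, m)%:R else b m) * 'C(y, m)%:R =
    \sum_(m < n.+1) b m * 'C(y, m)%:R.
  by apply: eq_bigr => i _; rewrite ltn_eqF.
rewrite big_ord_recr /= eqxx eqb leq_eqVlt => /predU1P[->|]; last first.
  by rewrite ltnS => le; rewrite bin_small ?ltnS // mulr0 addr0 IH.
by rewrite binn mulr1 addrC subrK.
Qed.

Lemma card_sets_between (T : finType) (Q S : {set T}) m : Q \subset S ->
  #|[set R : {set T} | [&& Q \subset R, R \subset S & #|R| == m]]| =
  if (#|Q| <= m)%N then 'C(#|S| - #|Q|, m - #|Q|) else 0%N.
Proof.
move=> QS; case: leqP => [Qm|mQ]; last first.
  apply/eqP; rewrite cards_eq0; apply/eqP/setP=> R; rewrite !inE.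
  apply/negP=> /and3P[/subset_leq_card QR _ /eqP Rm].
  by move: mQ; rewrite -Rm ltnNge QR.
rewrite -cardsDS // -cards_draws -[RHS](card_in_imset (f := fun A : {set T} => A :|: Q)).
  apply: eq_card => R; rewrite !inE; apply/and3P/imsetP.
    case=> QR RS /eqP Rm; exists (R :\: Q); last first.
      apply/setP=> x; rewrite !inE; case Qx: (x \in Q) => /=; last by rewrite orbF.
      exact: (subsetP QR).
    by rewrite inE setSD // cardsDS // Rm eqxx.
  case=> A; rewrite inE => /andP[AS /eqP Am] ->; split.
  - exact: subsetUr.
  - by rewrite subUset QS andbT (subset_trans AS) ?subsetDl.
  rewrite cardsU disjoint_setI0 ?cards0 ?Am ?subn0 ?subnK //.
  by move: AS; rewrite subsetD => /andP[].
move=> A B; rewrite !inE !subsetD => /andP[/andP[_ dA] _] /andP[/andP[_ dB] _] AB.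
have dis (C : {set T}) : [disjoint C & Q] -> (C :|: Q) :\: Q = C.
  by move=> dC; rewrite setDUl setDv setU0; apply/setDidPl.
by rewrite -(dis A dA) AB dis.
Qed.

End Fibers.

(** * Transversals to disjoint pairs in characteristic 2 *)

Section Pairs.
Variable r : nat.

(** The pairs are [{x, rev_ord x}] for [x < l]. In characteristic 2 the indicator
    function of the [l]-sets that split them is a polytabloid of shape [(r - l, l)],
    and that of the [k]-sets is its image under inclusion of [l]-sets in [k]-sets. *)
Definition splits_pairs l (S : {set 'I_r}) :=
  [forall x : 'I_r, (x < l)%N ==> ((rev_ord x \in S) != (x \in S))].

Lemma transversal_compl l S : splits_pairs l (~: S) = splits_pairs l S.
Proof. by apply: eq_forallb => x; rewrite !inE (inj_eq negb_inj). Qed.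

Lemma card_transversal l (S : {set 'I_r}) : (l + l <= r)%N -> splits_pairs l S ->
  #|[set x in S | (x < l)%N || (rev_ord x < l)%N]| = l.
Proof.
move=> l2 /forallP tS.
have lr : (l <= r)%N by apply: leq_trans l2; rewrite leq_addr.
pose f (i : 'I_l) := let x := widen_ord lr i in if x \in S then x else rev_ord x.
rewrite -[RHS]card_ord -[RHS](@card_imset _ _ f); last first.
  move=> i j; rewrite /f /=; have := ltn_ord i; have := ltn_ord j.
  by case: ifP; case: ifP => _ _ lj li /(congr1 val) /= ij;
    apply: val_inj => /=; lia.
apply: eq_card => x; rewrite !inE; apply/andP/imsetP.
  case=> xS /orP[xl|xl].
    exists (Ordinal xl) => //; rewrite /f.
    have -> : widen_ord lr (Ordinal xl) = x by apply: val_inj.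
    by rewrite xS.
  exists (Ordinal xl) => //; rewrite /f.
  have -> : widen_ord lr (Ordinal xl) = rev_ord x by apply: val_inj.
  have := tS (rev_ord x); rewrite xl /= rev_ordK xS.
  by case: ifP.
case=> i _ ->; rewrite /f; pose y := widen_ord lr i; rewrite -/y.
have yl : (y < l)%N := ltn_ord i.
case: ifP => yS; first by rewrite yl.
split; last by rewrite rev_ordK yl orbT.
by have := tS y; rewrite yl yS; case: (_ \in S).
Qed.

Lemma ex_transversal l k : (l <= k)%N -> (k + l <= r)%N ->
  exists2 S : {set 'I_r}, #|S| = k & splits_pairs l S.
Proof.
move=> lk klr; exists [set x : 'I_r | (x < k)%N]; last first.
  by apply/forallP=> x; apply/implyP=> xl; rewrite !inE /=; have := ltn_ord x; lia.
have kr : (k <= r)%N by lia.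
rewrite -[RHS]card_ord -[RHS](@card_imset _ _ (widen_ord kr)); last first.
  by move=> i j /(congr1 val) ij; apply: val_inj.
apply: eq_card => x; rewrite inE; apply/idP/imsetP=> [xk|[i _ ->]]; last exact: (ltn_ord i).
by exists (Ordinal xk) => //; apply: val_inj.
Qed.

End Pairs.

Section Transversals.
Variables (F : fieldType) (r : nat).
Hypothesis char2 : 2%N \in [pchar F].

(** In characteristic 2 the two terms of each orbit cancel. *)
Lemma sum_involution (T : finType) (P : pred T) (s : T -> T) (h : T -> F) :
  involutive s -> (forall t, P t -> [/\ P (s t), s t != t & h (s t) = h t]) ->
  \sum_(t | P t) h t = 0.
Proof.
move=> ss sP; pose Q t := (enum_rank t < enum_rank (s t))%N.
rewrite (bigID Q) /= [X in _ + X](reindex_inj (inv_inj ss)) /=.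
rewrite [X in _ + X](eq_big (fun t => P t && Q t) h) ?addrr_pchar2 // => t; last first.
  by case/andP=> /sP[]; rewrite ss.
have PsE : P (s t) = P t by apply/idP/idP=> /sP[]; rewrite ?ss.
rewrite PsE /Q ss -leqNgt leq_eqVlt; case Pt: (P t) => //=.
by case: eqP => // /val_inj/enum_rank_inj e; have [_ /eqP[]] := sP t Pt.
Qed.

(** If [S] contains both points of a pair, swapping them is a fixed-point free
    involution on the subsets of [S] that split the pairs; if [S] splits the pairs
    itself, these are the subsets that contain the part of [S] inside the pairs. *)
Lemma count_transversal_subsets l (S : {set 'I_r}) m : (l + l <= r)%N ->
  \sum_(R : {set 'I_r} | [&& R \subset S, #|R| == m & splits_pairs l R]) 1 =
  (splits_pairs l S)%:R * (if (l <= m)%N then 'C(#|S| - l, m - l)%:R else 0) :> F.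
Proof.
move=> l2; case tS: (splits_pairs l S).
  rewrite mul1r; set Q := [set x in S | (x < l)%N || (rev_ord x < l)%N].
  have Ql : #|Q| = l by apply: card_transversal.
  have QS : Q \subset S by apply/subsetP=> x; rewrite inE => /andP[].
  rewrite sumr_const.
  have -> : (if (l <= m)%N then 'C(#|S| - l, m - l)%:R else 0) =
            (if (l <= m)%N then 'C(#|S| - l, m - l) else 0%N)%:R :> F by case: ifP.
  rewrite -{2 3 4}Ql -card_sets_between //; congr _%:R; apply: eq_card => R.
  rewrite !inE; apply/and3P/and3P; last first.
    move=> [QR RS Rm]; split=> //; apply/forallP=> x; apply/implyP=> xl.
    have /forallP/(_ x) := tS; rewrite xl /=.
    have memR (y : 'I_r) : (y < l)%N || (rev_ord y < l)%N -> (y \in R) = (y \in S).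
      move=> yl; apply/idP/idP=> [/(subsetP RS)//|yS].
      by apply: (subsetP QR); rewrite inE yS.
    by rewrite !memR ?rev_ordK ?xl ?orbT.
  move=> [RS Rm tR]; split=> //; apply/subsetP=> x; rewrite inE => /andP[xS /orP xl].
  have [y [yl xy]] : exists y : 'I_r, (y < l)%N /\ (x = y \/ x = rev_ord y).
    by case: xl => xl; [exists x|exists (rev_ord x); rewrite rev_ordK]; auto.
  have /forallP/(_ y) := tS; have /forallP/(_ y) := tR; rewrite yl /=.
  have sub (z : 'I_r) : (z \in R) -> (z \in S) by apply: (subsetP RS).
  have := sub y; have := sub (rev_ord y); move: xS.
  case: xy => ->; case: (y \in R); case: (y \in S); case: (rev_ord y \in R);
    case: (rev_ord y \in S) => //= _ h1 h2; by [have := h1 isT|have := h2 isT|].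
rewrite mul0r; have [x /andP[xl /eqP xS]] : exists x : 'I_r,
    (x < l)%N && ((rev_ord x \in S) == (x \in S)).
  have /negbT := tS; rewrite negb_forall => /existsP[x].
  by rewrite negb_imply negbK => xP; exists x.
have xx : rev_ord x != x by rewrite -val_eqE /=; have := ltn_ord x; lia.
have [xinS|xninS] := boolP (x \in S); last first.
  apply: big_pred0 => R; apply/negP=> /and3P[RS _ /forallP/(_ x)]; rewrite xl /=.
  have nR (z : 'I_r) : z \notin S -> (z \in R) = false.
    by move=> zS; apply/negP=> /(subsetP RS); rewrite (negPf zS).
  by rewrite !nR // xS.
pose t := tperm x (rev_ord x).
pose s (R : {set 'I_r}) := t @: R.
have mem_s R y : (y \in s R) = (t y \in R).
  by rewrite -[y in LHS](tpermK x (rev_ord x)) mem_imset //; apply: perm_inj.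
apply: (sum_involution (s := s)).
  by move=> R; apply/setP=> y; rewrite !mem_s tpermK.
move=> R /and3P[RS Rm tR]; split=> //; last first.
  have /forallP/(_ x) := tR; rewrite xl /=; apply: contra_neq => /setP/(_ x) <-.
  by rewrite mem_s tpermL.
apply/and3P; split.
- apply/subsetP=> y; rewrite mem_s /t; case: tpermP => [-> _|-> _|_ _ /(subsetP RS)] //.
  by rewrite xS.
- by rewrite card_imset //; apply: perm_inj.
apply/forallP=> y; apply/implyP=> yl; rewrite !mem_s.
have [->|yx] := eqVneq y x.
  by rewrite /t tpermL tpermR eq_sym; have /forallP/(_ x) := tR; rewrite xl.
rewrite /t !tpermD; first by have /forallP/(_ y) := tR; rewrite yl.
- by rewrite eq_sym.
- by apply/eqP=> e; move: yl; rewrite -e /=; move: xl; lia.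
- by apply/eqP=> e; move: yl xl; have := congr1 val e; rewrite /=; have := ltn_ord y; lia.
by rewrite (inj_eq rev_ord_inj) eq_sym.
Qed.

(** Complementation exchanges supersets with subsets and preserves [splits_pairs]. *)
Lemma count_transversal_supersets l (R : {set 'I_r}) k :
  (l + l <= r)%N -> (k + l <= r)%N ->
  \sum_(S : {set 'I_r} | [&& R \subset S, #|S| == k & splits_pairs l S]) 1 =
  (splits_pairs l R)%:R * 'C(r - #|R| - l, r - k - l)%:R :> F.
Proof.
move=> l2 lk; rewrite (reindex_inj (can_inj (@setCK _))) /=.
rewrite (eq_bigl (fun S : {set 'I_r} =>
   [&& S \subset ~: R, #|S| == (r - k)%N & splits_pairs l S])); last first.
  move=> S; rewrite subsetC transversal_compl; congr [&& _, _ & _].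
  by rewrite [#|~: S|]cardsCs setCK card_ord; have := max_card S; rewrite card_ord; lia.
rewrite count_transversal_subsets // transversal_compl; congr (_ * _).
by rewrite ifT ?[#|~: R|]cardsCs ?setCK ?card_ord //; lia.
Qed.

Lemma sum1_subsets_capC (S S' : {set 'I_r}) m :
  \sum_(R : {set 'I_r} | (R \subset S :&: S') && (#|R| == m)) 1 =
  'C(#|S :&: S'|, m)%:R :> F.
Proof.
rewrite sumr_const; congr _%:R; rewrite -cards_draws.
by apply: eq_card => R; rewrite !inE.
Qed.

(** Summing first over the [m]-subsets [R] of [S] and then over the sets above [R]
    reduces the claim to the two counts above. *)
Lemma sum_transversal_inclusion l k m (S : {set 'I_r}) :
  (l + l <= r)%N -> (k + l <= r)%N ->
  \sum_(S' : {set 'I_r} | (#|S'| == k) && splits_pairs l S') 'C(#|S' :&: S|, m)%:R =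
  (splits_pairs l S)%:R *
    (if (l <= m)%N then 'C(r - m - l, r - k - l)%:R * 'C(#|S| - l, m - l)%:R else 0) :> F.
Proof.
move=> l2 lk.
under eq_bigr do rewrite -sum1_subsets_capC.
rewrite (exchange_big_dep (fun R : {set 'I_r} => (R \subset S) && (#|R| == m))) /=; last first.
  by move=> S' R _; rewrite subsetI => /andP[/andP[_ ->] ->].
rewrite (eq_bigr (fun R => (splits_pairs l R)%:R * 'C(r - m - l, r - k - l)%:R)); last first.
  move=> R /andP[RS /eqP Rm]; rewrite -[in RHS]Rm -count_transversal_supersets //.
  apply: eq_bigl => S'; rewrite subsetI RS Rm eqxx !andbT andbC.
  by case: (R \subset S').
rewrite -mulr_suml (eq_bigr (fun R => if splits_pairs l R then 1 else 0)); last first.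
  by move=> R _; case: (splits_pairs l R).
rewrite -big_mkcondr /= (eq_bigl (fun R : {set 'I_r} =>
   [&& R \subset S, #|R| == m & splits_pairs l R])); last by move=> R; rewrite andbA.
rewrite count_transversal_subsets //.
by case: ifP; rewrite ?mulr0 ?mul0r // -mulrA [X in _ * X]mulrC.
Qed.

Definition inclusion_eigenvalue l k m : F :=
  if (l <= m)%N then 'C(r - m - l, r - k - l)%:R * 'C(k - l, m - l)%:R else 0.

Lemma transversal_eigen_inclusion l k m (S : {set 'I_r}) :
  (l + l <= r)%N -> (k + l <= r)%N -> #|S| = k ->
  \sum_(S' : {set 'I_r} | (#|S'| == k) && splits_pairs l S') 'C(#|S' :&: S|, m)%:R =
  (splits_pairs l S)%:R * inclusion_eigenvalue l k m.
Proof. by move=> l2 lk Sk; rewrite sum_transversal_inclusion // Sk. Qed.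

End Transversals.

(** * Idempotent endomorphisms of set modules in characteristic 2 *)

Section Binomials.
Local Open Scope nat_scope.

(** The product of [t] and ['C(c, t)] is divisible by [c], but [2 ^ i] does not divide
    [t]. *)
Lemma bin_even i c t : 2 ^ i %| c -> 0 < t < 2 ^ i -> ~~ odd 'C(c, t).
Proof.
move=> ic /andP[t0 ti]; apply/negP=> oC.
have: 2 ^ i %| t * 'C(c, t).
  by case: t t0 {ti oC} => // t _; rewrite -mul_bin_diag dvdn_mulr.
rewrite Gauss_dvdl ?coprimeXl ?coprime2n // => /dvdn_leq.
by rewrite t0 leqNgt ti => /(_ isT).
Qed.

Lemma odd_sum_even n (P : pred 'I_n) (f : 'I_n -> nat) :
  (forall j, P j -> ~~ odd (f j)) -> odd (\sum_(j < n | P j) f j) = false.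
Proof.
move=> ef; apply/negbTE; rewrite -dvdn2; apply: dvdn_sum => j Pj.
by rewrite dvdn2 ef.
Qed.

(** In the Vandermonde sum all terms are even but the one taking nothing from [c]. *)
Lemma odd_bin_shift i c N j : 2 ^ i %| c -> j < 2 ^ i ->
  odd 'C(c + N, j) = odd 'C(N, j).
Proof.
move=> ic ji; rewrite -binomial.Vandermonde big_ord_recl bin0 mul1n subn0 oddD.
rewrite odd_sum_even ?addbF // => t _.
rewrite oddM negb_and (bin_even ic) // lift0 /=.
by rewrite (leq_ltn_trans _ ji).
Qed.

Lemma bin_double_even j : 0 < j -> ~~ odd 'C(j + j, j).
Proof.
case: j => // j _; rewrite addSn binS -(bin_sub (leq_addr j.+1 j)).
by rewrite addKn addnn odd_double.
Qed.

Lemma bin_trinomial s j : 'C(s + j, j) * 'C(s, j) = 'C(s + j, j + j) * 'C(j + j, j).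
Proof.
have [js|sj] := leqP j s; last first.
  by rewrite (@bin_small s j) // (@bin_small (s + j) (j + j)) ?muln0 ?mul0n // ltn_add2r.
apply/eqP; rewrite -(eqn_pmul2r (fact_gt0 j)) -(eqn_pmul2r (fact_gt0 j)).
rewrite -(eqn_pmul2r (fact_gt0 (s - j))); apply/eqP.
have e1 := @bin_fact (s + j) j (leq_addl _ _); rewrite addnK in e1.
have e2 := @bin_fact s j js.
have e3 := @bin_fact (j + j) j (leq_addl _ _); rewrite addnK in e3.
have := @bin_fact (s + j) (j + j); rewrite leq_add2r subnDr => /(_ js) e4.
transitivity ((s + j)`!); first by rewrite -e1 -e2; ring.
by rewrite -e4 -e3; ring.
Qed.

(** Without [c] the product is ['C(s + j, j + j) * 'C(j + j, j)], and the central
    binomial coefficient is even. *)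
Lemma odd_bin_shift_prod i c s j : 2 ^ i %| c -> 0 < j -> j < 2 ^ i ->
  ~~ odd ('C(c + s + j, j) * 'C(s, j)).
Proof.
move=> ic j0 ji; rewrite oddM -addnA (odd_bin_shift _ ic ji) -oddM bin_trinomial.
by rewrite oddM (negPf (bin_double_even j0)) andbF.
Qed.

(** Up to digits above [2 ^ a] the upper index is [2 ^ a] plus smaller digits, and the
    only odd term of the Vandermonde sum takes all of [2 ^ a]. *)
Lemma odd_bin_bit a c : odd (c %/ 2 ^ a) -> odd 'C(c + 2 ^ a + 2 ^ a, 2 ^ a).
Proof.
move=> oc; set q := c %/ 2 ^ a in oc *.
have -> : c + 2 ^ a + 2 ^ a = 2 ^ a.+1 * (q./2).+1 + (2 ^ a + c %% 2 ^ a).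
  rewrite {1}(divn_eq c (2 ^ a)) -/q -{1}(odd_double_half q) oc expnS -mul2n /= .
  by ring.
rewrite (@odd_bin_shift a.+1) ?dvdn_mulr // ?ltn_exp2l //.
rewrite -binomial.Vandermonde big_ord_recr /= binn subnn bin0 oddD.
rewrite odd_sum_even // => t _; rewrite oddM negb_and.
have [t0|t0] := posnP t.
  by rewrite t0 subn0 (@bin_small (c %% _)) ?orbT // ltn_mod expn_gt0.
by rewrite (@bin_even a) // t0 ltn_ord.
Qed.

End Binomials.

Section TwoParts.
Variables (F : fieldType) (r : nat).
Hypothesis char2 : 2%N \in [pchar F].

Lemma natr_odd n : n%:R = (odd n)%:R :> F.
Proof.
rewrite -{1}(odd_double_half n) natrD -mul2n natrM (pcharf0 char2).
by rewrite mul0r addr0.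
Qed.

Local Notation ev := (inclusion_eigenvalue F r).

Lemma eigenvalue_top l k : (l <= k)%N -> ev l k k = 1.
Proof. by move=> lk; rewrite /inclusion_eigenvalue lk !binn mulr1. Qed.

Lemma eigenvalue_binomial l k m : (l <= m <= k)%N -> (k + k <= r)%N ->
  ev l k m = ('C((r - (k + k)) + (k - l) + (k - m), k - m) * 'C(k - l, k - m))%:R.
Proof.
move=> /andP[lm mk] kr; rewrite /inclusion_eigenvalue lm natrM.
congr (_%:R * _%:R); last first.
  by rewrite -bin_sub; [congr 'C(_, _)|]; lia.
by rewrite -bin_sub; [congr 'C(_, _)|]; lia.
Qed.

Lemma eigenvalue_zero i l k m : (k + k <= r)%N -> (k < 2 ^ i)%N ->
  (2 ^ i %| r - (k + k))%N -> (m < k)%N -> ev l k m = 0.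
Proof.
move=> kr ki ir mk; have [lm|] := leqP l m; last first.
  by move=> ml; rewrite /inclusion_eigenvalue leqNgt ml.
have lmk : (l <= m <= k)%N by rewrite lm ltnW.
rewrite eigenvalue_binomial // natr_odd (negPf (odd_bin_shift_prod _ ir _ _)) //.
  by rewrite subn_gt0.
by rewrite (leq_ltn_trans _ ki) // leq_subr.
Qed.

Section Idempotent.
Variables (k : nat) (f b : nat -> F).
Hypothesis kr : (k + k <= r)%N.
Hypothesis fb : forall x, (x <= k)%N -> f x = \sum_(m < k.+1) b m * 'C(x, m)%:R.
Hypothesis f_idem : forall S S'' : {set 'I_r}, #|S| = k -> #|S''| = k ->
  \sum_(S' : {set 'I_r} | #|S'| == k) f #|S :&: S'| * f #|S' :&: S''| =
  f #|S :&: S''|.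

(** Inclusion of [R] in the [k]-sets, followed by the endomorphism [f]. *)
Definition up (R S : {set 'I_r}) : F :=
  \sum_(S' : {set 'I_r} | (#|S'| == k) && (R \subset S')) f #|S' :&: S|.

Definition kernel_eigenvalue l : F := \sum_(m < k.+1) b m * ev l k m.

Lemma transversal_eigen_kernel l (S : {set 'I_r}) : (l <= k)%N -> #|S| = k ->
  \sum_(S' : {set 'I_r} | (#|S'| == k) && splits_pairs l S') f #|S' :&: S| =
  (splits_pairs l S)%:R * kernel_eigenvalue l.
Proof.
move=> lk Sk.
have bnd (S' : {set 'I_r}) : (#|S' :&: S| <= k)%N.
  by rewrite -Sk subset_leq_card // subsetIr.
under eq_bigr do rewrite fb //.
rewrite exchange_big mulr_sumr /=; apply: eq_bigr => m _.
rewrite -mulr_sumr transversal_eigen_inclusion // 1?mulrCA //.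
- by apply: leq_trans kr; rewrite leq_add.
- by rewrite (leq_trans _ kr) // leq_add2l.
Qed.

Lemma sum_up_l (R S : {set 'I_r}) : #|S| = k ->
  \sum_(S' : {set 'I_r} | #|S'| == k) up R S' * f #|S' :&: S| = up R S.
Proof.
move=> Sk; under eq_bigr do rewrite mulr_suml.
rewrite (exchange_big_dep (fun S' : {set 'I_r} => (#|S'| == k) && (R \subset S'))) //=.
apply: eq_bigr => C /andP[/eqP Ck RC]; rewrite -f_idem //.
by apply: eq_bigl => S'; rewrite Ck RC eqxx !andbT.
Qed.

(** An indicator function on [k]-sets is the image under inclusion of the one on
    [l]-sets, so [up] inherits the eigenvalue of [f]. *)
Lemma sum_transversal_up l (B : {set 'I_r}) : (l <= k)%N -> #|B| = k ->
  \sum_(A : {set 'I_r} | (#|A| == l) && splits_pairs l A) up A B =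
  (splits_pairs l B)%:R * kernel_eigenvalue l.
Proof.
move=> lk Bk; rewrite -transversal_eigen_kernel //.
rewrite (exchange_big_dep (fun S' : {set 'I_r} => #|S'| == k)) /=; last first.
  by move=> A S' _ /andP[].
rewrite [RHS]big_mkcondr; apply: eq_bigr => S' /eqP S'k.
rewrite [LHS](eq_bigr (fun=> f #|S' :&: B| * 1)) => [|A _]; last by rewrite mulr1.
rewrite -mulr_sumr (eq_bigl (fun A : {set 'I_r} =>
  [&& A \subset S', #|A| == l & splits_pairs l A])) => [|A]; last first.
  by rewrite S'k eqxx andbC.
rewrite count_transversal_subsets //; last by apply: leq_trans kr; rewrite leq_add.
rewrite leqnn subnn bin0 mulr1.
by case: splits_pairs; rewrite ?mulr1 ?mulr0.
Qed.

(** On [l]-sets [up] is a combination of maps that restrict to an [m]-subset and then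
    include it in a [k]-set, [m <= l]. Composing with [f] once more changes nothing,
    as [f] is idempotent, but kills the terms with [m < l]. Only the multiple [c l] of
    [up] itself remains, and the sets splitting [l] pairs, on which the lower terms
    vanish, identify [c l] with the eigenvalue. *)
Lemma up_eigen l : (l <= k)%N ->
  (forall m (R S : {set 'I_r}), (m < l)%N -> #|R| = m -> #|S| = k -> up R S = 0) ->
  forall R S : {set 'I_r}, #|R| = l -> #|S| = k ->
  up R S = kernel_eigenvalue l * up R S.
Proof.
move=> lk up0 R S Rl Sk.
have l2 : (l + l <= r)%N by apply: leq_trans kr; rewrite leq_add.
have kl : (k + l <= r)%N by rewrite (leq_trans _ kr) // leq_add2l.
have upinv (s : 'S_r) (A B : {set 'I_r}) : up (s @: A) (s @: B) = up A B.
  have si : injective (fun A : {set 'I_r} => s @: A) by apply: imset_inj; apply: perm_inj.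
  rewrite /up (reindex_inj si) /=; apply: eq_big => C.
    rewrite card_imset; last exact: perm_inj.
    congr (_ && _); apply/subsetP/subsetP=> AC x; last first.
      by case/imsetP=> y /AC yC ->; apply: imset_f.
    by move/(imset_f s)/AC; rewrite mem_imset //; apply: perm_inj.
  move=> _; rewrite -imsetI; last by apply: in2W; apply: perm_inj.
  by rewrite card_imset //; apply: perm_inj.
have [h0 h0P] := invariant_set_kernel (0 : F) l k upinv.
have [c cP] := newton_interpolation h0 l.
have upE (A B : {set 'I_r}) : #|A| = l -> #|B| = k -> up A B =
    \sum_(m < l.+1) c m * \sum_(Q : {set 'I_r} | (Q \subset A :&: B) && (#|Q| == m)) 1.
  move=> Al Bk; rewrite (h0P A B) // cP; last by rewrite -Al subset_leq_card ?subsetIl.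
  by apply: eq_bigr => m _; rewrite sum1_subsets_capC.
have cl : c l = kernel_eigenvalue l.
  have [B Bk tB] := @ex_transversal r l k lk kl.
  have := sum_transversal_up lk Bk; rewrite tB mul1r => <-.
  under eq_bigr => A /andP[/eqP Al _] do rewrite upE //.
  rewrite exchange_big big_ord_recr /= big1 ?add0r => [|m _]; last first.
      rewrite -mulr_sumr; under eq_bigr do rewrite sum1_subsets_capC.
      by rewrite sum_transversal_inclusion // leqNgt ltn_ord /= !mulr0.
    rewrite -mulr_sumr; under eq_bigr do rewrite sum1_subsets_capC.
    by rewrite sum_transversal_inclusion // leqnn tB subnn bin0 binn !mulr1.
rewrite -[LHS]sum_up_l // -cl.
under eq_bigr => S' /eqP S'k do rewrite upE // mulr_suml.
rewrite exchange_big /=.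
have key m : \sum_(S' : {set 'I_r} | #|S'| == k)
    c m * (\sum_(Q : {set 'I_r} | (Q \subset R :&: S') && (#|Q| == m)) 1) * f #|S' :&: S| =
    c m * \sum_(Q : {set 'I_r} | (Q \subset R) && (#|Q| == m)) up Q S.
  rewrite mulr_sumr; under eq_bigr do rewrite mulr_sumr mulr_suml.
  rewrite (exchange_big_dep (fun Q : {set 'I_r} => (Q \subset R) && (#|Q| == m))) /=.
    apply: eq_bigr => Q /andP[QR Qm]; rewrite mulr_sumr.
    by apply: eq_big => [S'|S' _]; rewrite ?mulr1 // subsetI QR Qm andbT.
  by move=> S' Q _; rewrite subsetI => /andP[/andP[-> _] ->].
under eq_bigr do rewrite key.
rewrite big_ord_recr /= big1 ?add0r => [|m _]; last first.
  by rewrite big1 ?mulr0 // => Q /andP[_ /eqP Qm]; apply: up0 Sk => //; rewrite ?Qm.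
congr (_ * _); apply: big_pred1 => Q /=; rewrite -Rl.
apply/andP/eqP => [[QR /eqP Ql]|->]; last by rewrite subxx eqxx.
by apply/eqP; rewrite eqEcard QR Ql leqnn.
Qed.


Lemma up_top (R S : {set 'I_r}) : #|R| = k -> up R S = f #|R :&: S|.
Proof.
move=> Rk; apply: big_pred1 => S' /=; apply/andP/eqP => [[/eqP S'k RS']|->].
  by apply/esym/eqP; rewrite eqEcard RS' S'k Rk leqnn.
by rewrite subxx Rk eqxx.
Qed.

Lemma idem_kernel_zero : (forall l, (l <= k)%N -> kernel_eigenvalue l != 1) ->
  forall R S : {set 'I_r}, #|R| = k -> #|S| = k -> f #|R :&: S| = 0.
Proof.
move=> ev1 R S Rk Sk; rewrite -up_top //.
suff up0 l : (l <= k)%N -> forall R' S' : {set 'I_r}, #|R'| = l -> #|S'| = k -> up R' S' = 0.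
  exact: (up0 k).
elim/ltn_ind: l => l IH lk R' S' R'l S'k; apply/eqP.
have /eqP := up_eigen lk (fun m R S ml => IH m ml (leq_trans (ltnW ml) lk) R S) R'l S'k.
rewrite eq_sym -subr_eq0 -[X in _ - X]mul1r -mulrBl mulf_eq0 subr_eq0.
by rewrite (negPf (ev1 l lk)).
Qed.

Lemma up_zero_eigenvalue l : (l <= k)%N ->
  (forall R S : {set 'I_r}, #|R| = l -> #|S| = k -> up R S = 0) ->
  kernel_eigenvalue l = 0.
Proof.
move=> lk up0.
have kl : (k + l <= r)%N by rewrite (leq_trans _ kr) // leq_add2l.
have [B Bk tB] := @ex_transversal r l k lk kl.
have := sum_transversal_up lk Bk; rewrite tB mul1r => <-.
by rewrite big1 // => A /andP[/eqP Al _]; apply: up0.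
Qed.

End Idempotent.

(** Every eigenvalue of [f] is its coefficient [b k] at the identity map. If it is not
    1 then [f] vanishes, and if it is 1 then [1 - f] has eigenvalue 0 and vanishes. *)
Lemma idem_kernel_trivial i k (f : nat -> F) :
  (k + k <= r)%N -> (k < 2 ^ i)%N -> (2 ^ i %| r - (k + k))%N ->
  (forall S S'' : {set 'I_r}, #|S| = k -> #|S''| = k ->
    \sum_(S' : {set 'I_r} | #|S'| == k) f #|S :&: S'| * f #|S' :&: S''| =
    f #|S :&: S''|) ->
  (forall R S : {set 'I_r}, #|R| = k -> #|S| = k -> f #|R :&: S| = 0) \/
  (forall R S : {set 'I_r}, #|R| = k -> #|S| = k -> f #|R :&: S| = (R == S)%:R).
Proof.
move=> kr ki ir fi; have [b fb] := newton_interpolation f k.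
have evE (c : nat -> F) l : (l <= k)%N -> kernel_eigenvalue k c l = c k.
  move=> lk; rewrite /kernel_eigenvalue big_ord_recr /= eigenvalue_top // mulr1.
  by rewrite big1 ?add0r // => m _; rewrite (eigenvalue_zero _ kr ki ir) ?mulr0.
have [bk1|bk] := eqVneq (b k) 1; last first.
  by left; apply: (idem_kernel_zero kr fb fi) => l lk; rewrite evE.
right=> R S Rk Sk.
have eqI (A B : {set 'I_r}) : #|A| = k -> #|B| = k -> (#|A :&: B| == k) = (A == B).
  move=> Ak Bk; apply/eqP/eqP=> [ABk|->]; last by rewrite setIid.
  have /eqP AB : A :&: B == A by rewrite eqEcard subsetIl ABk Ak leqnn.
  by apply/eqP; rewrite eqEcard Ak Bk leqnn andbT; apply/setIidPl.
pose f' x := (x == k)%:R - f x; pose b' m := (m == k)%:R - b m.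
have fb' x : (x <= k)%N -> f' x = \sum_(m < k.+1) b' m * 'C(x, m)%:R.
  move=> xk; under eq_bigr do rewrite mulrBl; rewrite sumrB -fb //; congr (_ - _).
  rewrite big_ord_recr /= eqxx mul1r big1 ?add0r => [|m _]; last first.
    by rewrite ltn_eqF ?mul0r.
  have [->|xk'] := eqVneq x k; first by rewrite binn.
  by rewrite bin_small // ltn_neqAle xk'.
apply/esym/eqP; rewrite -eqI // -subr_eq0 -/(f' _); apply/eqP.
apply: (idem_kernel_zero kr fb') Rk Sk => [S1 S2 S1k S2k|l lk]; last first.
  by rewrite evE // /b' eqxx bk1 subrr eq_sym oner_eq0.
have delta (g : {set 'I_r} -> F) (A : {set 'I_r}) : #|A| = k ->
    \sum_(S' : {set 'I_r} | #|S'| == k) (#|A :&: S'| == k)%:R * g S' = g A.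
  move=> Ak; rewrite (bigD1 A) ?Ak //= setIid Ak eqxx mul1r big1 ?addr0 // => S'.
  by case/andP=> /eqP S'k S'A; rewrite eqI // eq_sym (negPf S'A) mul0r.
rewrite /f'; under eq_bigr do rewrite mulrBl.
rewrite sumrB delta //; under [X in _ - X]eq_bigr do rewrite mulrBr.
rewrite sumrB fi //; under [X in _ - (X - _)]eq_bigr do rewrite mulrC setIC.
rewrite (delta (fun A => f #|S1 :&: A|)) // subrr subr0.
by [].
Qed.

(** For even [r] the eigenvalues for [k - 1] and [k] pairs agree; the former is 0
    because [f] kills all that is included from smaller sets. *)
Lemma even_idem_kernel_zero k (f : nat -> F) : ~~ odd r -> (0 < k)%N ->
  (k + k <= r)%N ->
  (forall S S'' : {set 'I_r}, #|S| = k -> #|S''| = k ->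
    \sum_(S' : {set 'I_r} | #|S'| == k) f #|S :&: S'| * f #|S' :&: S''| =
    f #|S :&: S''|) ->
  (forall R S : {set 'I_r}, (#|R| < k)%N -> #|S| = k -> up k f R S = 0) ->
  forall R S : {set 'I_r}, #|R| = k -> #|S| = k -> f #|R :&: S| = 0.
Proof.
move=> r2 k0 kr fi up0 R S Rk Sk; have [b fb] := newton_interpolation f k.
have evE l : (l <= k <= l.+1)%N -> kernel_eigenvalue k b l = b k.
  move=> /andP[lk kl]; rewrite /kernel_eigenvalue big_ord_recr /= eigenvalue_top //.
  rewrite mulr1 big1 ?add0r // => m _.
  have [lm|ml] := leqP l m; last by rewrite /inclusion_eigenvalue leqNgt ml mulr0.
  have mk := ltn_ord m.
    have lmk : (l <= m <= k)%N by lia.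
  rewrite eigenvalue_binomial // natr_odd.
  have -> : (k - m = 1)%N by lia.
  have -> : (k - l = 1)%N by lia.
  by rewrite bin1 muln1 -addnA oddD oddB // addnn odd_double (negPf r2) mulr0.
have bk : b k = 0.
  rewrite -(evE k.-1) ?prednK ?leqnn ?leq_pred //.
  apply: (up_zero_eigenvalue kr fb); first exact: leq_pred.
  by move=> A B Ak; apply: up0; rewrite Ak prednK.
rewrite -(up_top _ _ Rk) (up_eigen kr fb fi (leqnn k)) //; last first.
  by move=> m A B mk Am; apply: up0; rewrite Am.
by rewrite evE ?leqnn ?leqnSn // bk mul0r.
Qed.

Lemma eigenvalue_bit a k : (k + k <= r)%N -> (2 ^ a <= k)%N ->
  odd ((r - (k + k)) %/ 2 ^ a)%N -> ev (k - 2 ^ a) k (k - 2 ^ a) = 1.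
Proof.
move=> kr ak oa; rewrite eigenvalue_binomial ?leqnn ?leq_subr //.
by rewrite subKn // binn muln1 natr_odd odd_bin_bit.
Qed.

Lemma eigenvalue_top_lower k m : (m < k)%N -> ev k k m = 0.
Proof. by move=> mk; rewrite /inclusion_eigenvalue leqNgt mk. Qed.

End TwoParts.

(** * Permutation modules as kernels *)

(** Matrices numbered by [enum_val] are handled as functions of two points, for which
    matrix products are sums over points. *)
Section Kernels.
Variable F : fieldType.

Definition vmx (T : finType) (phi : T -> F) : 'rV[F]_#|T| :=
  \row_j phi (enum_val j).

Definition kmx (T T' : finType) (A : T -> T' -> F) : 'M[F]_(#|T|, #|T'|) :=
  \matrix_(i, j) A (enum_val i) (enum_val j).

Definition kernel_of (T T' : finType) (M : 'M[F]_(#|T|, #|T'|)) t t' : F :=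
  M (enum_rank t) (enum_rank t').

Lemma kernel_ofK (T T' : finType) (M : 'M[F]_(#|T|, #|T'|)) : kmx (kernel_of M) = M.
Proof. by apply/matrixP=> i j; rewrite mxE /kernel_of !enum_valK. Qed.

Lemma kmxK (T T' : finType) (A : T -> T' -> F) t t' : kernel_of (kmx A) t t' = A t t'.
Proof. by rewrite /kernel_of mxE !enum_rankK. Qed.

Lemma eq_kmx (T T' : finType) (A B : T -> T' -> F) :
  (forall t t', A t t' = B t t') -> kmx A = kmx B.
Proof. by move=> AB; apply/matrixP=> i j; rewrite !mxE. Qed.

Lemma sum_enum_val (T : finType) (h : T -> F) :
  \sum_(i < #|T|) h (enum_val i) = \sum_t h t.
Proof. by rewrite [RHS](reindex _ (onW_bij _ (@enum_val_bij T))). Qed.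

Lemma mul_kmx (T T' T'' : finType) (A : T -> T' -> F) (B : T' -> T'' -> F) :
  kmx A *m kmx B = kmx (fun t t'' => \sum_t' A t t' * B t' t'').
Proof.
apply/matrixP=> i j; rewrite !mxE.
rewrite -(sum_enum_val (fun t' => A (enum_val i) t' * B t' (enum_val j))).
by apply: eq_bigr => l _; rewrite !mxE.
Qed.

Lemma kernel_of_mul (T T' T'' : finType) (M : 'M[F]_(#|T|, #|T'|)) (N : 'M_(#|T'|, #|T''|)) t t'' :
  kernel_of (M *m N) t t'' = \sum_t' kernel_of M t t' * kernel_of N t' t''.
Proof. by rewrite -{1}(kernel_ofK M) -{1}(kernel_ofK N) mul_kmx kmxK. Qed.

Lemma mul_vmx (T T' : finType) (phi : T -> F) (A : T -> T' -> F) :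
  vmx phi *m kmx A = vmx (fun t' => \sum_t phi t * A t t').
Proof.
apply/rowP=> j; rewrite !mxE -(sum_enum_val (fun t => phi t * A t (enum_val j))).
by apply: eq_bigr => l _; rewrite !mxE.
Qed.

Lemma eq_vmx (T : finType) (phi psi : T -> F) : phi =1 psi -> vmx phi = vmx psi.
Proof. by move=> e; apply/rowP=> j; rewrite !mxE. Qed.

Lemma scale_vmx (T : finType) c (phi : T -> F) : c *: vmx phi = vmx (fun t => c * phi t).
Proof. by apply/rowP=> j; rewrite !mxE. Qed.

Lemma vmx_neq0 (T : finType) (phi : T -> F) t : phi t != 0 -> vmx phi != 0.
Proof.
apply: contraNneq => /rowP/(_ (enum_rank t)); rewrite !mxE enum_rankK.
by move=> ->.
Qed.

Lemma vmx_eq0 (T : finType) (phi : T -> F) t : vmx phi = 0 -> phi t = 0.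
Proof. by move/rowP/(_ (enum_rank t)); rewrite !mxE enum_rankK. Qed.

End Kernels.

Section PermutationModules.
Variables (F : fieldType) (gT : finGroupType).

Lemma act_mxE (T : finType) (to : {action gT &-> T}) g :
  act_mx F to g = kmx (fun t t' => (to t g == t')%:R).
Proof. by []. Qed.

Lemma perm_reprE (T : finType) (to : {action gT &-> T}) g :
  perm_repr F to g = kmx (fun t t' => (to t g == t')%:R).
Proof. by []. Qed.

Section TwoActions.
Variables (T T' : finType) (to : {action gT &-> T}) (to' : {action gT &-> T'}).

Definition equivariant (A : T -> T' -> F) :=
  forall g t t', A (to t g) (to' t' g) = A t t'.

Lemma mul_act_kmx g (A : T -> T' -> F) :
  act_mx F to g *m kmx A = kmx (fun t => A (to t g)).
Proof.
rewrite act_mxE mul_kmx; apply: eq_kmx => t t'; rewrite (bigD1 (to t g)) //= eqxx mul1r.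
by rewrite big1 ?addr0 // => u /negPf ut; rewrite eq_sym ut mul0r.
Qed.

Lemma mul_kmx_act g (A : T -> T' -> F) :
  kmx A *m act_mx F to' g = kmx (fun t t' => A t (to' t' g^-1%g)).
Proof.
rewrite act_mxE mul_kmx; apply: eq_kmx => t t'; rewrite (bigD1 (to' t' g^-1%g)) //= actKV eqxx mulr1.
rewrite big1 ?addr0 // => u ut; case: eqP => [ut'|]; last by rewrite mulr0.
by rewrite -ut' actK eqxx in ut.
Qed.

Lemma equivariant_kmx (A : T -> T' -> F) : equivariant A ->
  forall g, act_mx F to g *m kmx A = kmx A *m act_mx F to' g.
Proof.
move=> eA g; rewrite mul_act_kmx mul_kmx_act; apply: eq_kmx => t t'.
by rewrite -[RHS](eA g) actKV.
Qed.

Lemma kmx_equivariant (A : T -> T' -> F) :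
  (forall g, act_mx F to g *m kmx A = kmx A *m act_mx F to' g) -> equivariant A.
Proof.
move=> cA g t t'; have := cA g; rewrite mul_act_kmx mul_kmx_act.
move/(congr1 (fun M => kernel_of M t (to' t' g))); rewrite !kmxK => ->.
by rewrite actK.
Qed.

Definition ring_kernel (S : finType) (toS : {action gT &-> S}) (e : 'M[F]_#|[set: gT]|) :=
  kernel_of (gring_op (perm_repr F toS) e).

Lemma ring_kernel_intertwine e (A : T -> T' -> F) t s : equivariant A ->
  \sum_t' ring_kernel to e t t' * A t' s = \sum_s' A t s' * ring_kernel to' e s' s.
Proof.
move=> eA; have := @gring_op_intertwine F gT _ _ _ (perm_repr F to) (perm_repr F to')
  (kmx A) e (fun x _ => equivariant_kmx eA x).
move/(congr1 (fun M => kernel_of M t s)); rewrite !kernel_of_mul.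
by under eq_bigr do rewrite kmxK; under [in RHS]eq_bigr do rewrite kmxK.
Qed.

End TwoActions.

Section Equivariant.
Variables (T T' : finType) (to : {action gT &-> T}) (to' : {action gT &-> T'}).

Lemma ring_kernel_map e (pi : T -> T') t s : (forall g u, pi (to u g) = to' (pi u) g) ->
  ring_kernel to' e (pi t) s = \sum_(t' | pi t' == s) ring_kernel to e t t'.
Proof.
move=> epi; have eA : equivariant to to' (fun u v => (pi u == v)%:R).
  by move=> g u v; rewrite epi (inj_eq (@act_inj _ _ _ _ _)).
have := ring_kernel_intertwine e t s eA.
rewrite (eq_bigr (fun t' => if pi t' == s then ring_kernel to e t t' else 0)) => [|t' _]; last first.
  by case: ifP; rewrite ?mulr1 ?mulr0.
rewrite -big_mkcond /= => ->.
rewrite (bigD1 (pi t)) //= eqxx mul1r big1 ?addr0 // => u ut.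
by rewrite eq_sym (negPf ut) mul0r.
Qed.

Lemma ring_kernel_inj e (pi : T -> T') t t' : injective pi ->
  (forall g u, pi (to u g) = to' (pi u) g) ->
  ring_kernel to e t t' = ring_kernel to' e (pi t) (pi t').
Proof.
move=> ipi epi; rewrite (ring_kernel_map _ _ _ epi).
by rewrite (eq_bigl (pred1 t')) ?big_pred1_eq // => u; rewrite /= (inj_eq ipi).
Qed.

End Equivariant.

Section OneAction.
Variables (T : finType) (to : {action gT &-> T}).

Lemma centg_kernel M : centgmx (perm_repr F to) M <-> equivariant to to (kernel_of M).
Proof.
split=> [/centgmxP cM|eM].
  by apply: kmx_equivariant => g; rewrite kernel_ofK -[LHS]cM ?inE.
apply/centgmxP=> g _; rewrite -[M]kernel_ofK; exact: esym (equivariant_kmx eM g).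
Qed.

Lemma ring_kernel_equivariant e : central_idempotent e ->
  equivariant to to (ring_kernel to e).
Proof. by case=> Ze _; apply/centg_kernel/gring_op_center. Qed.

Lemma ring_kernel_idem e t t'' : central_idempotent e ->
  \sum_t' ring_kernel to e t t' * ring_kernel to e t' t'' = ring_kernel to e t t''.
Proof. by move=> Ie; rewrite -kernel_of_mul central_idem_op. Qed.

(** A fixed point spans a trivial submodule. *)
Lemma ring_kernel_fixed e t t' : gring_op (triv_repr F [set: gT]) e = 0 ->
  (forall g, to t g = t) -> ring_kernel to e t t' = 0.
Proof.
move=> te ft; pose d := vmx (fun u => (t == u)%:R : F).
have dG : {in [set: gT], forall x, triv_repr F [set: gT] x *m d = d *m perm_repr F to x}.
  move=> x _; rewrite [triv_repr F _ x]/= mul1mx.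
  rewrite perm_reprE mul_vmx; apply: eq_vmx => u; rewrite (bigD1 t) //= eqxx mul1r ft.
  by rewrite big1 ?addr0 // => v vt; rewrite eq_sym (negPf vt) mul0r.
have := gring_op_intertwine e dG; rewrite te mul0mx.
rewrite -[gring_op _ e]kernel_ofK mul_vmx => /esym/vmx_eq0 => /(_ t').
rewrite (bigD1 t) //= eqxx mul1r big1 ?addr0 // => v vt.
by rewrite eq_sym (negPf vt) mul0r.
Qed.

Lemma nonprincipal_zero :
  (forall e t t', central_idempotent e -> gring_op (triv_repr F [set: gT]) e = 0 ->
     ring_kernel to e t t' = 0) ->
  ~ has_nonprincipal_summand (perm_repr F to).
Proof.
move=> zero /nonprincipal_idem[e [Ie te /eqP[]]].
by rewrite -[LHS]kernel_ofK; apply/matrixP=> i j; rewrite !mxE; apply: zero.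
Qed.

Lemma perm_nonprincipal_decomposable (t0 : T) :
  has_nonprincipal_summand (perm_repr F to) -> decomposable (perm_repr F to) 1%:M.
Proof.
apply: (@nonprincipal_decomposable _ _ _ _ _ (vmx (fun=> 1))).
  by apply: (@vmx_neq0 _ _ _ t0); apply: oner_neq0.
move=> g _; rewrite perm_reprE mul_vmx; apply: eq_vmx => t.
rewrite (bigD1 (to t g^-1%g)) //= actKV eqxx mulr1 big1 ?addr0 // => u ut.
case: eqP => [ug|]; last by rewrite mulr0.
by rewrite -ug actK eqxx in ut.
Qed.

Lemma decomposable_kernel (A : T -> T -> F) (w0 w1 : T -> F) (c : F) (t0 t1 : T) :
  equivariant to to A -> w0 t0 != 0 -> (forall t', \sum_t w0 t * A t t' = 0) ->
  w1 t1 != 0 -> c != 0 -> (forall t', \sum_t w1 t * A t t' = c * w1 t') ->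
  decomposable (perm_repr F to) 1%:M.
Proof.
move=> eA w00 w0A w10 c0 w1A.
apply: (@decomposable_eigen _ _ _ _ _ (kmx A) (vmx w0) (vmx w1) c) => //.
- by apply/centg_kernel=> g t t'; rewrite !kmxK eA.
- exact: vmx_neq0 w00.
- by rewrite mul_vmx; apply/rowP=> j; rewrite !mxE w0A.
- exact: vmx_neq0 w10.
by rewrite mul_vmx scale_vmx; apply: eq_vmx.
Qed.

(** A decomposition is the same as an idempotent endomorphism other than 0 and 1. *)
Lemma indecomposable_kernel (t0 : T) :
  (forall A : T -> T -> F, equivariant to to A ->
     (forall t t'', \sum_t' A t t' * A t' t'' = A t t'') ->
     (forall t t', A t t' = 0) \/ (forall t t', A t t' = (t == t')%:R)) ->
  indecomposable (perm_repr F to) 1%:M.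
Proof.
move=> triv; split.
  apply/eqP=> /matrixP/(_ (enum_rank t0) (enum_rank t0)).
  by rewrite !mxE eqxx => /eqP; rewrite oner_eq0.
case/idem_of_decomposable=> E [cE EE E0 E1].
have [||A0|A1] := triv (kernel_of E); first exact/centg_kernel.
- by move=> t t''; rewrite -kernel_of_mul EE.
- by case/eqP: E0; rewrite -(kernel_ofK E); apply/matrixP=> i j; rewrite !mxE A0.
case/eqP: E1; rewrite -(kernel_ofK E); apply/matrixP=> i j; rewrite !mxE A1.
by rewrite (inj_eq enum_val_inj).
Qed.

End OneAction.
End PermutationModules.

(** * Tabloids and maps between their modules *)

Section SetModule.
Variables (F : fieldType) (r : nat).

Definition set_perm_action : {action 'S_r &-> {set 'I_r}} := ('P^*)%act.

Lemma set_perm_actionE (S : {set 'I_r}) s : set_perm_action S s = s @: S.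
Proof. by []. Qed.

Lemma card_set_perm (S : {set 'I_r}) (s : 'S_r) : #|s @: S| = #|S|.
Proof. by rewrite card_imset //; apply: perm_inj. Qed.

(** The projections to the sets of one size are endomorphisms. *)
Lemma set_kernel_card e (S S' : {set 'I_r}) : #|S| != #|S'| ->
  ring_kernel set_perm_action e S S' = 0 :> F.
Proof.
move=> SS'; pose A (R R' : {set 'I_r}) : F := ((R == R') && (#|R| == #|S'|))%:R.
have eA : equivariant set_perm_action set_perm_action A.
  move=> g R R'; rewrite /A !set_perm_actionE card_set_perm.
  by rewrite (inj_eq (imset_inj (@perm_inj _ g))).
have := ring_kernel_intertwine e S S' eA.
rewrite (bigD1 S') //= /A !eqxx mulr1 big1 ?addr0 => [->|R RS']; last first.
  by rewrite (negPf RS') mulr0.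
by rewrite big1 // => R _; rewrite (negPf SS') andbF mul0r.
Qed.

Hypothesis char2 : 2%N \in [pchar F].

(** Induction on [k]: the idempotent commutes with inclusion of smaller sets, which
    it kills already, so [even_idem_kernel_zero] applies. *)
Lemma set_kernel_zero e : ~~ odd r -> central_idempotent e ->
  gring_op (triv_repr F [set: 'S_r]) e = 0 ->
  forall k, (k + k <= r)%N -> forall S S' : {set 'I_r}, #|S| = k -> #|S'| = k ->
  ring_kernel set_perm_action e S S' = 0.
Proof.
move=> r2 Ie te; set K := ring_kernel _ e; elim/ltn_ind=> k IH kr S S' Sk S'k.
have [k0|k0] := posnP k.
  apply: ring_kernel_fixed => // s.
  by move: Sk; rewrite k0 => /cards0_eq->; rewrite set_perm_actionE imset0.
have [f fP] := invariant_set_kernel (0 : F) k k (ring_kernel_equivariant set_perm_action Ie).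
rewrite -/K in fP; rewrite fP //.
apply: (even_idem_kernel_zero char2 r2 k0 kr) => // {S S' Sk S'k} [S S'' Sk S''k|R S Rk Sk].
  rewrite -fP // -[RHS]ring_kernel_idem // -/K [RHS](bigID (fun S' : {set 'I_r} => #|S'| == k)) /=.
  rewrite [X in _ = _ + X]big1 ?addr0 => [|S' S'k]; last first.
    by rewrite /K set_kernel_card ?mul0r // Sk eq_sym.
  by apply: eq_bigr => S' /eqP S'k; rewrite !fP.
pose A (R' S' : {set 'I_r}) : F := [&& #|R'| == #|R|, #|S'| == k & R' \subset S']%:R.
have eA : equivariant set_perm_action set_perm_action A.
  move=> g R' S'; rewrite /A !set_perm_actionE !card_set_perm; congr (_ && (_ && _))%:R.
  apply/subsetP/subsetP=> AC x; last by case/imsetP=> y /AC yC ->; apply: imset_f.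
  by move/(imset_f g)/AC; rewrite mem_imset //; apply: perm_inj.
have := esym (ring_kernel_intertwine e R S eA); rewrite -/K.
rewrite [RHS]big1 => [<-|R' _]; last first.
  rewrite /A; case: eqP => [R'R|]; last by rewrite mulr0.
  by rewrite (IH #|R|) ?mul0r //; lia.
rewrite /up big_mkcond; apply: eq_bigr => S' _; rewrite /A eqxx.
by case: andP => [[/eqP S'k _]|]; rewrite ?mul0r // mul1r fP.
Qed.

End SetModule.

Section RowMaps.
Variables (r : nat).

Lemma tabloidP lam (t : tabloid r lam) i : #|[set x | val t x == i]| = nth 0%N lam i.
Proof. by have /forallP/(_ i)/eqP := valP t. Qed.

Lemma tabloid_actE lam (t : tabloid r lam) s x :
  val (tabloid_action r lam t s) x = val t (s^-1%g x).
Proof. by rewrite /= /tabloid_fact ffunE. Qed.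

(** Tabloids are considered here for arbitrary compositions, so that merging rows need
    not produce a partition. *)
Section Regroup.
Variables (lam mu : seq nat) (q : 'I_(size lam) -> 'I_(size mu)).
Hypothesis lam_mu : forall j, (\sum_(i | q i == j) nth 0 lam i)%N = nth 0%N mu j.

Lemma regroup_subproof (t : tabloid r lam) :
  is_tabloid ([ffun x => q (val t x)] : {ffun 'I_r -> 'I_(size mu)}).
Proof.
apply/forallP=> j; rewrite -lam_mu; apply/eqP.
rewrite -sum1_card (partition_big (val t) (fun i => q i == j)) /=; last first.
  by move=> x; rewrite inE ffunE.
apply: eq_bigr => i /eqP qi; rewrite -(tabloidP t) -sum1_card; apply: eq_bigl => x.
rewrite !inE ffunE; case: (val t x =P i) => [->|_]; by rewrite ?andbF ?qi ?eqxx.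
Qed.

Definition regroup (t : tabloid r lam) : tabloid r mu := Sub _ (regroup_subproof t).

Lemma regroupE t x : val (regroup t) x = q (val t x).
Proof. by rewrite /= ffunE. Qed.

Lemma regroup_act (s : 'S_r) t :
  regroup (tabloid_action r lam t s) = tabloid_action r mu (regroup t) s.
Proof. by apply/val_inj/ffunP=> x; rewrite regroupE !tabloid_actE regroupE. Qed.

End Regroup.

Section PermuteRows.
Variables (lam : seq nat) (p : {perm 'I_(size lam)}).
Hypothesis lam_p : forall i, nth 0%N lam (p i) = nth 0%N lam i.

Lemma permute_rows_subproof j : (\sum_(i | p i == j) nth 0 lam i)%N = nth 0%N lam j.
Proof.
rewrite (big_pred1 (p^-1%g j)) => [|i]; first by rewrite -lam_p permKV.
by rewrite /= (canF_eq (permK p)).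
Qed.

Definition permute_rows := regroup permute_rows_subproof.

End PermuteRows.

Section Equality.
Variable lam : seq nat.

Lemma singleton_row (t : tabloid r lam) (l : 'I_(size lam)) : nth 0%N lam l = 1%N ->
  exists x, forall y, (val t y == l) = (y == x).
Proof.
move=> l1; have /eqP/cards1P[x ux] : #|[set x | val t x == l]| = 1%N by rewrite tabloidP.
by exists x => y; have /setP/(_ y) := ux; rewrite !inE.
Qed.

Lemma tabloid_eqP (t t' : tabloid r lam) : (forall x, val t x = val t' x) -> t = t'.
Proof. by move=> tt'; apply/val_inj/ffunP. Qed.

End Equality.
End RowMaps.

Section Merge.
Variables (F : fieldType) (r : nat).
Hypothesis char2 : 2%N \in [pchar F].

(** The map [q] merges the one-point rows [i] and [j]; its fibres on tabloids are the
    pairs [{t, s t}], where [s] swaps these rows. Since [e] kills the module of [mu],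
    its kernel is unchanged when [s] is applied on either side, so in characteristic
    2 the terms of [e * e] cancel in pairs, and [e = e * e] vanishes. *)
Lemma merge_kernel_zero (lam mu : seq nat) (q : 'I_(size lam) -> 'I_(size mu))
    (i j : 'I_(size lam)) e :
  (forall m, (\sum_(l | q l == m) nth 0 lam l)%N = nth 0%N mu m) ->
  i != j -> nth 0%N lam i = 1%N -> nth 0%N lam j = 1%N ->
  (forall a b, q a = q b -> a = b \/ b = tperm i j a) -> q i = q j ->
  central_idempotent e ->
  (forall u u', ring_kernel (tabloid_action r mu) e u u' = 0 :> F) ->
  forall t t', ring_kernel (tabloid_action r lam) e t t' = 0.
Proof.
move=> lam_mu ij li lj qP qij Ie K0 t t'.
set K := ring_kernel _ e.
have pP x : nth 0%N lam (tperm i j x) = nth 0%N lam x.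
  by case: tpermP => [->|->|//]; rewrite li lj.
pose s : tabloid r lam -> tabloid r lam := permute_rows pP.
have sE u x : val (s u) x = tperm i j (val u x) by rewrite /s regroupE.
have ss : involutive s by move=> u; apply: tabloid_eqP => x; rewrite !sE tpermK.
have sfix u : s u != u.
  have [x xP] := singleton_row u li; apply/eqP=> /(congr1 (fun v : tabloid r lam => val v x)); rewrite sE.
  have /eqP -> : val u x == i by rewrite xP.
  by rewrite tpermL => /eqP; rewrite eq_sym (negPf ij).
have fibre u u' : regroup lam_mu u = regroup lam_mu u' -> u' = u \/ u' = s u.
  move=> /(congr1 val)/ffunP uu'.
  have {}uu' x : val u' x = val u x \/ val u' x = tperm i j (val u x).
    by have := uu' x; rewrite !regroupE => /qP[->|->]; auto.
  have [x xP] := singleton_row u li; have [y yP] := singleton_row u lj.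
  have [x' xP'] := singleton_row u' li; have [y' yP'] := singleton_row u' lj.
  have ux : val u x = i by apply/eqP; rewrite xP.
  have uy : val u y = j by apply/eqP; rewrite yP.
  have oth z : z != x -> z != y -> val u' z = val u z.
    by rewrite -xP -yP => zi zj; case: (uu' z) => // ->; rewrite tpermD // eq_sym.
  have xy : x != y by rewrite -yP ux.
  have := uu' x; have := uu' y; rewrite ux uy tpermL tpermR => uy' ux'.
  case: ux' uy' => [ux' [uy'|uy']|ux' [uy'|uy']].
  - left; apply: tabloid_eqP => z; have [->|zx] := eqVneq z x; first by rewrite ux ux'.
    by have [->|zy] := eqVneq z y; [rewrite uy uy'|apply: oth].
  - have /eqP xz : x == x' by rewrite -xP' ux'.
    have /eqP yz : y == x' by rewrite -xP' uy'.
    by rewrite xz yz eqxx in xy.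
  - have /eqP xz : x == y' by rewrite -yP' ux'.
    have /eqP yz : y == y' by rewrite -yP' uy'.
    by rewrite xz yz eqxx in xy.
  right; apply: tabloid_eqP => z; rewrite sE.
  have [->|zx] := eqVneq z x; first by rewrite ux ux' tpermL.
  have [->|zy] := eqVneq z y; first by rewrite uy uy' tpermR.
  by rewrite oth // tpermD // eq_sym ?xP ?yP.
have rs u : regroup lam_mu (s u) = regroup lam_mu u.
  apply: tabloid_eqP => x; rewrite !(regroupE lam_mu) sE.
  by case: tpermP => [->|->|//].
have Ks u u' : K u (s u') = K u u'.
  have := ring_kernel_map e u (regroup lam_mu u') (@regroup_act _ _ _ _ lam_mu).
  rewrite K0 (bigD1 u') //= (bigD1 (s u')) /=; last by rewrite rs eqxx sfix.
  rewrite big1 ?addr0 => [/esym/eqP|v /andP[/andP[/eqP ev vu'] vs]]; last first.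
    by case: (fibre _ _ (esym ev)) => ev'; rewrite ev' eqxx in vu' vs.
  by rewrite addr_eq0 oppr_pchar2 // => /eqP.
have sK u u' : K (s u) u' = K u u'.
  have eA : equivariant (tabloid_action r lam) (tabloid_action r lam) (fun v w => (s v == w)%:R : F).
    by move=> g v w; rewrite /s /permute_rows regroup_act (inj_eq (@act_inj _ _ _ _ _)).
  have := ring_kernel_intertwine e u u' eA; rewrite -/K.
  rewrite (bigD1 (s u')) //= ss eqxx mulr1 big1 ?addr0 => [|v vs]; last first.
    by rewrite (canF_eq ss) (negPf vs) mulr0.
  rewrite (bigD1 (s u)) //= eqxx mul1r big1 ?addr0 => [<-|v vs]; first by rewrite Ks.
  by rewrite eq_sym (negPf vs) mul0r.
rewrite -[LHS]ring_kernel_idem // -/K; apply: (sum_involution char2 ss) => v _.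
by rewrite Ks sK.
Qed.

Lemma merge_adjacent_kernel_zero (lam mu : seq nat) (q : 'I_(size lam) -> 'I_(size mu)) c e :
  (forall m, (\sum_(l | q l == m) nth 0 lam l)%N = nth 0%N mu m) ->
  (c.+1 < size lam)%N -> nth 0%N lam c = 1%N -> nth 0%N lam c.+1 = 1%N ->
  (forall i, val (q i) = i - (c < i))%N -> central_idempotent e ->
  (forall u u', ring_kernel (tabloid_action r mu) e u u' = 0 :> F) ->
  forall t t', ring_kernel (tabloid_action r lam) e t t' = 0.
Proof.
move=> lam_mu c1 lc lc1 qE Ie K0.
apply: (merge_kernel_zero lam_mu (i := Ordinal (ltnW c1)) (j := Ordinal c1)) => //.
- by rewrite -val_eqE /= ltn_eqF.
- move=> x y /(congr1 val); rewrite !qE => xy.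
  have [->|nxy] := eqVneq x y; [by left | right].
  rewrite -val_eqE /= in nxy.
  case: tpermP => [E|E|E1 E2]; apply: val_inj => /=.
  + by move: xy nxy; rewrite E /=; lia.
  + by move: xy nxy; rewrite E /=; lia.
  by have := introN eqP E1; have := introN eqP E2; rewrite -!val_eqE /=; lia.
by apply: val_inj; rewrite !qE /=; lia.
Qed.

End Merge.

(** * Partitions with two parts *)

Section SecondRow.
Variables (r a k : nat).
Hypothesis akr : (a + k)%N = r.
Local Notation T := (tabloid r [:: a; k]).

Definition second_row (t : T) : {set 'I_r} := [set x | val t x == ord_max].

Lemma second_row_act (s : 'S_r) t :
  second_row (tabloid_action r [:: a; k] t s) = set_perm_action r (second_row t) s.
Proof.
apply/setP=> x; rewrite inE tabloid_actE set_perm_actionE -{2}[x](permKV s).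
by rewrite mem_imset ?inE //; apply: perm_inj.
Qed.

Lemma card_second_row t : #|second_row t| = k.
Proof. exact: (tabloidP t ord_max). Qed.

Lemma second_row_inj : injective second_row.
Proof.
move=> t t' /setP tt'; apply: tabloid_eqP => x; have := tt' x; rewrite !inE.
case: (val t x) (val t' x) => [[|[|//]] i1] [[|[|//]] i2] //= _; exact: val_inj.
Qed.

Lemma second_row_surj (S : {set 'I_r}) : #|S| = k -> exists t, second_row t = S.
Proof.
move=> Sk; pose f := [ffun x => if x \in S then ord_max else ord0 : 'I_2].
have fP : is_tabloid (f : {ffun 'I_r -> 'I_(size [:: a; k])}).
  apply/forallP=> -[[|[|//]] i2] /=.
    have -> : a = #|~: S| by rewrite [#|~: S|]cardsCs setCK card_ord Sk -akr addnK.
    by apply/eqP/eq_card=> x; rewrite !inE ffunE; case: (x \in S).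
  by rewrite -Sk; apply/eqP/eq_card=> x; rewrite !inE ffunE; case: (x \in S).
exists (Sub f fP); apply/setP=> x; rewrite inE /= ffunE.
by case: (x \in S).
Qed.

Lemma sum_second_row (F : fieldType) (h : {set 'I_r} -> F) :
  \sum_t h (second_row t) = \sum_(S : {set 'I_r} | #|S| == k) h S.
Proof.
transitivity (\sum_(S in second_row @: [set: T]) h S).
  rewrite big_imset /=; last by apply: in2W; apply: second_row_inj.
  by apply: eq_bigl => t; rewrite inE.
apply: eq_bigl => S; apply/imsetP/eqP => [[t _ ->]|/second_row_surj[t <-]].
  exact: card_second_row.
by exists t.
Qed.

Lemma two_part_kernel (F : fieldType) (A : T -> T -> F) :
  equivariant (tabloid_action r [:: a; k]) (tabloid_action r [:: a; k]) A ->
  exists f : nat -> F, forall t t', A t t' = f #|second_row t :&: second_row t'|.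
Proof.
move=> eA; pose B S S' := \sum_(t | second_row t == S) \sum_(t' | second_row t' == S') A t t'.
have BE t t' : B (second_row t) (second_row t') = A t t'.
  rewrite /B (big_pred1 t) => [|u]; last by rewrite (inj_eq second_row_inj).
  by rewrite (big_pred1 t') // => u; rewrite (inj_eq second_row_inj).
have [s R S|f fP] := @invariant_set_kernel r F 0 B k k; last first.
  by exists f => t t'; rewrite -BE fP ?card_second_row.
have inj : injective (fun u => tabloid_action r [:: a; k] u s) by apply: act_inj.
have sE u (R' : {set 'I_r}) : (second_row (tabloid_action r [:: a; k] u s) == s @: R') = (second_row u == R').
  by rewrite second_row_act (inj_eq (imset_inj (@perm_inj _ s))).
rewrite /B (reindex_inj inj); apply: eq_big => [t|t _]; first exact: sE.
rewrite (reindex_inj inj); apply: eq_big => [t'|t' _]; [exact: sE|exact: eA].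
Qed.

Lemma inclusion_equivariant (F : fieldType) (h : nat -> F) :
  equivariant (tabloid_action r [:: a; k]) (tabloid_action r [:: a; k])
    (fun t t' => h #|second_row t :&: second_row t'|).
Proof.
move=> s t t'; rewrite !second_row_act !set_perm_actionE -imsetI ?card_set_perm //.
by apply: in2W; apply: perm_inj.
Qed.

(** The endomorphisms are [b1 + b0 J], where [J] is the all-ones matrix and
    [J ^+ 2 = r J = 0]; idempotency forces [b0 = 0]. *)
Lemma natural_indecomposable (F : fieldType) : k = 1%N -> r%:R = 0 :> F ->
  indecomposable (young_perm_repr F r [:: a; k]) 1%:M.
Proof.
move=> k1 r0.
have rgt0 : (0 < r)%N by rewrite -akr k1 addn1.
have [t0 _] : exists t0, second_row t0 = [set Ordinal rgt0].
  by apply: second_row_surj; rewrite cards1 k1.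
apply: (indecomposable_kernel t0) => A /two_part_kernel[f fA] AA.
have inter t t' : #|second_row t :&: second_row t'| = (t == t').
  rewrite -(inj_eq second_row_inj).
  have := card_second_row t; have := card_second_row t'; rewrite k1.
  move=> /eqP/cards1P[x ->] /eqP/cards1P[y ->].
  have [/set1_inj->|yx] := eqVneq [set y] [set x]; first by rewrite setIid cards1.
  apply/eqP; rewrite cards_eq0 setI_eq0 disjoints1 inE.
  by apply: contra yx => /eqP->.
have cardT : #|{: T}|%:R = 0 :> F.
  rewrite -sum1_card natr_sum (sum_second_row (fun=> 1%:R)) -natr_sum sum1_card k1.
  rewrite -[RHS]r0 -[in RHS](bin1 r) -[in RHS](card_ord r) -card_draws.
  by congr _%:R; apply: eq_card => S; rewrite [RHS]inE.
pose b0 := f 0%N; pose b1 := f 1%N - f 0%N.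
have AE t t' : A t t' = b0 + b1 * (t == t')%:R.
  by rewrite fA inter /b0 /b1; case: eqP => _; rewrite ?mulr1 ?mulr0 ?addr0 // addrC subrK.
have sum1 (g : T -> F) t : \sum_t' (t == t')%:R * g t' = g t.
  rewrite (bigD1 t) //= eqxx mul1r big1 ?addr0 // => u ut.
  by rewrite eq_sym (negPf ut) mul0r.
have main (t t'' : T) : b0 *+ 2 * b1 + b1 * b1 * (t == t'')%:R = b0 + b1 * (t == t'')%:R.
  transitivity (A t t''); last exact: AE.
  rewrite -AA; under [in RHS]eq_bigr do rewrite !AE mulrDl.
  rewrite big_split /=; under [X in _ = _ + X]eq_bigr do rewrite -mulrA.
  rewrite -!mulr_sumr sum1 big_split /= sumr_const -mulr_sumr.
  rewrite (eq_bigr (fun i => (t'' == i)%:R * 1)) => [|i _]; last by rewrite mulr1 eq_sym.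
  have z : b0 *+ #|{: T}| = 0 by rewrite -mulr_natr cardT mulr0.
  by rewrite sum1 [b0 *+ #|_|]z; ring.
have [t1 t01] : exists t1, t0 != t1.
  apply/existsP; apply: contraTT (oner_neq0 F); rewrite negb_exists negbK => /forallP e.
  rewrite -cardT (@eq_card1 _ t0) // => t.
  by have := e t; rewrite negbK !inE eq_sym => ->.
have m1 := main t0 t1; have m0 := main t0 t0.
rewrite (negPf t01) !mulr0 !addr0 in m1; rewrite eqxx !mulr1 m1 in m0.
have {m0} b11 : b1 * b1 = b1 by apply: addrI m0.
have [b10|b10] := eqVneq b1 0.
  left=> t t'; rewrite AE b10 mul0r addr0 -m1 b10 mulr0 //.
have b1E : b1 = 1 by apply: (mulfI b10); rewrite b11 mulr1.
right=> t t'; rewrite AE b1E mul1r.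
have /addrI -> : b0 + b0 = b0 + 0 by rewrite addr0 -mulr2n -{2}m1 b1E mulr1.
by rewrite add0r.
Qed.

Section CharTwo.
Variable F : fieldType.
Hypothesis char2 : 2%N \in [pchar F].
Hypothesis kr : (k + k <= r)%N.

Lemma two_part_kernel_zero e t t' : ~~ odd r -> central_idempotent e ->
  gring_op (triv_repr F [set: 'S_r]) e = 0 ->
  ring_kernel (tabloid_action r [:: a; k]) e t t' = 0.
Proof.
move=> r2 Ie te; rewrite (ring_kernel_inj _ _ _ second_row_inj second_row_act).
exact: (set_kernel_zero char2 r2 Ie te kr (card_second_row t) (card_second_row t')).
Qed.

Lemma two_part_indecomposable i : (k < 2 ^ i)%N -> (2 ^ i %| r - (k + k))%N ->
  indecomposable (young_perm_repr F r [:: a; k]) 1%:M.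
Proof.
move=> ki ir; have [S Sk _] := @ex_transversal r 0 k (leq0n k) ltac:(lia).
have [t0 _] := second_row_surj Sk.
apply: (indecomposable_kernel t0) => A /two_part_kernel[f fA] AA.
have [S1 S2 S1k S2k|f0|f1] := idem_kernel_trivial char2 kr ki ir (f := f).
- have [[t1 <-] [t2 <-]] := (second_row_surj S1k, second_row_surj S2k).
  rewrite -fA -AA -(sum_second_row (fun S => f #|second_row t1 :&: S| * f #|S :&: second_row t2|)).
  by apply: eq_bigr => u _; rewrite -!fA.
- by left=> t t'; rewrite fA f0 ?card_second_row.
by right=> t t'; rewrite fA f1 ?card_second_row // (inj_eq second_row_inj).
Qed.

(** For [m = k - 2 ^ d] the endomorphism [N_m] kills the sets splitting [k] pairs and
    fixes those splitting [m] pairs. *)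
Lemma two_part_decomposable d : (2 ^ d <= k)%N -> odd ((r - (k + k)) %/ 2 ^ d)%N ->
  decomposable (young_perm_repr F r [:: a; k]) 1%:M.
Proof.
move=> dk od; set m := (k - 2 ^ d)%N.
have d0 : (0 < 2 ^ d)%N by rewrite expn_gt0.
have mk : (m < k)%N by rewrite /m; lia.
have eigen l t : (l <= k)%N ->
    \sum_t' (splits_pairs l (second_row t'))%:R * 'C(#|second_row t' :&: second_row t|, m)%:R =
    inclusion_eigenvalue F r l k m * (splits_pairs l (second_row t))%:R :> F.
  move=> lk.
  rewrite (sum_second_row (fun S => (splits_pairs l S)%:R * 'C(#|S :&: second_row t|, m)%:R)).
  rewrite mulrC -transversal_eigen_inclusion ?card_second_row //; try lia.
  rewrite [RHS]big_mkcondr; apply: eq_bigr => S _.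
  by case: splits_pairs; rewrite ?mul1r ?mul0r.
have ex l : (l <= k)%N -> exists t, splits_pairs l (second_row t).
  move=> lk; have [S Sk tS] := @ex_transversal r l k lk ltac:(lia).
  by have [t tSE] := second_row_surj Sk; exists t; rewrite tSE.
have [t0 t0P] := ex k (leqnn k); have [t1 t1P] := ex m (ltnW mk).
apply: (@decomposable_kernel _ _ _ _ _ (fun t' => (splits_pairs k (second_row t'))%:R)
  (fun t' => (splits_pairs m (second_row t'))%:R) 1 t0 t1
  (inclusion_equivariant (fun x => 'C(x, m)%:R))).
- by rewrite t0P oner_eq0.
- by move=> t; rewrite eigen // eigenvalue_top_lower // mul0r.
- by rewrite t1P oner_eq0.
- exact: oner_neq0.
by move=> t; rewrite eigen ?(ltnW mk) // eigenvalue_bit.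
Qed.

End CharTwo.
End SecondRow.

(** * The sum of all transpositions *)

Section TranspositionSum.
Variables (F : fieldType) (r : nat).
Local Notation G := [set: 'S_r].
Local Notation aG := (regular_repr F G).

Definition transpositions : {set 'S_r} :=
  [set tperm p.1 p.2 | p : 'I_r * 'I_r & (p.1 < p.2)%N].

Definition transposition_sum : 'M[F]_#|G| := \sum_(s in transpositions) (aG s - 1%:M).

Lemma tperm_transposition (i j : 'I_r) : i != j -> tperm i j \in transpositions.
Proof.
move=> ij; case: (ltngtP i j) => [lt|lt|/val_inj e]; last by rewrite e eqxx in ij.
  by apply/imsetP; exists (i, j); rewrite ?inE.
by apply/imsetP; exists (j, i); rewrite ?inE 1?tpermC.
Qed.

Lemma transpositions_conj (g s : 'S_r) : (s ^ g \in transpositions)%g = (s \in transpositions).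
Proof.
have one (h u : 'S_r) : u \in transpositions -> (u ^ h \in transpositions)%g.
  case/imsetP=> -[i j]; rewrite inE /= => ij ->; rewrite tpermJ.
  by apply: tperm_transposition; rewrite (inj_eq perm_inj) -val_eqE ltn_eqF.
by apply/idP/idP=> [/(one g^-1%g)|/one]; rewrite ?conjgK.
Qed.

Lemma sum_transpositions (V : nmodType) (h : 'S_r -> V) :
  \sum_(s in transpositions) h s = \sum_(j < r) \sum_(i < r | (i < j)%N) h (tperm i j).
Proof.
rewrite (exchange_big_dep xpredT) //= pair_big_dep /=.
rewrite big_imset /=; first by apply: eq_bigl => p; rewrite inE.
move=> [i j] [i' j']; rewrite !inE /= => ij ij' e.
have := congr1 (fun s : 'S_r => s i) e; rewrite tpermL.
case: tpermP => [-> ->|ij2 ji|_ _ ji] //.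
  by move: ij ij'; rewrite ij2 -ji; lia.
by rewrite ji ltnn in ij.
Qed.

Lemma transposition_sum_central : (transposition_sum \in 'Z(group_ring F G))%MS.
Proof.
rewrite sub_capmx memmx_cent_envelop; apply/andP; split.
  rewrite /transposition_sum; elim/big_ind: _ => [|x y|s _].
  - by rewrite linear0 sub0mx.
  - by move=> X Y; rewrite linearD addmx_sub.
  rewrite linearB addmx_sub ?envelop_mx_id ?inE //.
  by rewrite eqmx_opp envelop_mx1.
apply/centgmxP=> g _; rewrite /transposition_sum mulmx_suml mulmx_sumr.
rewrite [RHS](reindex_inj (conjg_inj g)) /=.
apply: eq_big => [s|s _]; first by rewrite transpositions_conj.
rewrite mulmxBl mulmxBr mul1mx mulmx1 -!repr_mxM ?inE //.
by rewrite conjgC.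
Qed.

Lemma transposition_sum_triv : gring_op (triv_repr F G) transposition_sum = 0.
Proof.
rewrite linear_sum big1 // => s _; rewrite linearB /= gring_opG ?inE // gring_op1.
by rewrite subrr.
Qed.

Lemma transposition_sum_act (T : finType) (to : {action 'S_r &-> T}) (phi : T -> F) :
  vmx phi *m gring_op (perm_repr F to) transposition_sum =
  vmx (fun t => \sum_(s in transpositions) (phi (to t s) - phi t)).
Proof.
rewrite linear_sum mulmx_sumr; apply/rowP=> j; rewrite summxE mxE.
rewrite [RHS](reindex_inj invg_inj) /=; apply: eq_big => [s|s _].
  apply/idP/idP=> /imsetP[p pP sE]; apply/imsetP; exists p => //.
    by rewrite sE tpermV.
  by rewrite -[s]invgK sE tpermV.
rewrite linearB /= gring_opG ?inE // gring_op1 mulmxBr mulmx1 perm_reprE mul_vmx !mxE.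
congr (_ - _); rewrite (bigD1 (to (enum_val j) s^-1%g)) //= actKV eqxx mulr1.
rewrite big1 ?addr0 // => u ut; case: eqP => [us|]; last by rewrite mulr0.
by rewrite -us actK eqxx in ut.
Qed.

(** Young's argument: the column antisymmetrizer commutes with the sum of
    transpositions, fixes up to sign the transpositions inside a column, and kills
    the effect of every other one that moves entries between rows. *)
Section Antisymmetrizer.
Variables (T : finType) (to : {action 'S_r &-> T}).
Variables (R C : 'I_r -> nat) (psi : ('I_r -> nat) -> T -> F).
Hypothesis eq_psi : forall R1 R2, R1 =1 R2 -> psi R1 =1 psi R2.
Hypothesis psi_act : forall R' g t, psi R' (to t g) = psi (R' \o g) t.
Hypothesis diagram : forall i j, (R i < R j)%N -> exists2 z, C z = C j & R z = R i.

Definition column_group := [set s : 'S_r | [forall x, C (s x) == C x]].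

Lemma column_groupM (s u : 'S_r) : u \in column_group ->
  (s * u \in column_group)%g = (s \in column_group).
Proof.
rewrite !inE => /forallP uC; apply: eq_forallb => x.
by rewrite permM (eqP (uC _)).
Qed.

Definition antisymmetrize (psi' : T -> F) t : F :=
  \sum_(s in column_group) (-1) ^+ s * psi' (to t s).

Lemma tperm_column i j : C i = C j -> tperm i j \in column_group.
Proof. by move=> ij; rewrite inE; apply/forallP=> x; case: tpermP => [->|->|]; rewrite ?ij. Qed.

Lemma antisymmetrize_act psi' i j t : C i = C j -> i != j ->
  antisymmetrize (fun t => psi' (to t (tperm i j))) t = - antisymmetrize psi' t.
Proof.
move=> ij ij'; have cij := tperm_column ij.
rewrite /antisymmetrize -sumrN.
rewrite [RHS](reindex_inj (mulIg (tperm i j))) /=.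
apply: eq_big => [s|s _]; first by rewrite column_groupM.
by rewrite odd_permM odd_tperm ij' addbT signrN mulNr opprK actM.
Qed.

(** The terms of [s] and of [s * tperm i j] have opposite signs. Pairing them by the
    parity of [s] gives the vanishing in characteristic 2 as well. *)
Lemma antisymmetrize_zero psi' i j t : C i = C j -> i != j ->
  (forall u, psi' (to u (tperm i j)) = psi' u) -> antisymmetrize psi' t = 0.
Proof.
move=> ij ij' inv; have cij := tperm_column ij.
rewrite /antisymmetrize (bigID (fun s : 'S_r => odd_perm s)) /=.
rewrite [X in X + _](reindex_inj (mulIg (tperm i j))) /=.
rewrite [X in X + _](eq_bigl (fun s : 'S_r => (s \in column_group) && ~~ odd_perm s)) => [|s].
  rewrite -big_split /= big1 // => s /andP[_ /negPf os].
  by rewrite odd_permM odd_tperm ij' os actM inv /= expr0 expr1 mul1r mulN1r addNr.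
by rewrite column_groupM // odd_permM odd_tperm ij' addbT.
Qed.

(** When [psi R] is moved by the transposition of [i] and [j] and then antisymmetrized,
    the result is a multiple of [antisymmetrize (psi R)]: by 1 inside a row, by -1
    inside a column and by 0 otherwise. The weight is 1 minus this factor. *)
Definition tableau_weight i j : nat :=
  if R i == R j then 0 else if C i == C j then 2 else 1.

Lemma antisymmetrize_eigen t :
  \sum_(s in transpositions)
     (antisymmetrize (psi R) (to t s) - antisymmetrize (psi R) t) =
  - (\sum_(j < r) \sum_(i < r | (i < j)%N) tableau_weight i j)%N%:R *
    antisymmetrize (psi R) t.
Proof.
transitivity (\sum_(s in transpositions)
    (antisymmetrize (fun u => psi R (to u s)) t - antisymmetrize (psi R) t)).
  rewrite !sumrB; congr (_ - _); rewrite /antisymmetrize exchange_big [RHS]exchange_big.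
  apply: eq_bigr => s _; rewrite [RHS](reindex_inj (conjg_inj s)) /=.
  apply: eq_big => [u|u _]; first by rewrite transpositions_conj.
  by rewrite -!actM -conjgC.
rewrite sum_transpositions natr_sum mulNr mulr_suml -[RHS]sumrN; apply: eq_bigr => j _.
rewrite natr_sum mulr_suml -[RHS]sumrN; apply: eq_bigr => i ij.
rewrite -mulNr.
have {}ij : i != j by rewrite -val_eqE ltn_eqF.
have psiE u : psi R (to u (tperm i j)) = psi (R \o tperm i j) u by rewrite psi_act.
rewrite /tableau_weight; case: eqP => [Rij|Rij].
  rewrite oppr0 mul0r; apply/eqP; rewrite subr_eq0; apply/eqP; apply: eq_bigr => s _.
  rewrite psiE; congr (_ * _); apply: eq_psi => x /=.
  by case: tpermP => [->|->|].
case: eqP => [Cij|Cij].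
  by rewrite antisymmetrize_act //; ring.
rewrite (_ : antisymmetrize (fun u => psi R (to u (tperm i j))) t = 0); first by rewrite mulN1r add0r.
(* [z] is the entry of row [R a] in the column of [b]; after the swap of [a] and [b]
   the entries [b] and [z] lie in the same row and column. *)
have kill a b : a != b -> C a <> C b -> (R a < R b)%N ->
    antisymmetrize (fun u => psi R (to u (tperm a b))) t = 0.
  move=> ab Cab Rab; have [z zb za] := diagram Rab.
  have bz : b != z by apply: contraTneq Rab => ->; rewrite za ltnn.
  have az : a != z by apply: contra_notN Cab => /eqP->; rewrite zb.
  apply: (@antisymmetrize_zero _ b z) => // u; rewrite !psi_act; apply: eq_psi => x /=.
  have [->|xb] := eqVneq x b; first by rewrite tpermL tpermR tpermD ?za // eq_sym.
  have [->|xz] := eqVneq x z; first by rewrite tpermR tpermR tpermD ?za // eq_sym.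
  by rewrite (tpermD (x := b)) // eq_sym.
case: (ltngtP (R i) (R j)) => // lt; first exact: kill.
have := kill j i; rewrite tpermC; apply=> //; first by rewrite eq_sym.
by apply/nesym.
Qed.

End Antisymmetrizer.
End TranspositionSum.

(** * Eigenvectors attached to tableaux *)

Section Cells.
Variable s : seq (nat * nat).

(** The [size s] first entries occupy the cells [s], given by row and column; all
    others lie in row 0, each in a column of its own. *)
Definition cell_row x := (nth (0, x) s x).1%N.
Definition cell_col x := (nth (0, x) s x).2%N.

Definition is_diagram := [&& uniq s, all (fun p => p.2 < size s)%N s
  & all (fun p => all (fun a => (a, p.2) \in s) (iota 0 p.1)) s].

Definition cell_weight i j : nat :=
  if cell_row i == cell_row j then 0 else if cell_col i == cell_col j then 2 else 1.

(** The sum of the contents of the one-row diagram minus that of the diagram with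
    the cells [s], the remaining entries completing its first row. *)
Definition total_weight r : nat := \sum_(j < r) \sum_(i < j) cell_weight i j.

Hypothesis sP : is_diagram.

Lemma cell_row0 x : (size s <= x)%N -> cell_row x = 0%N.
Proof. by move=> sx; rewrite /cell_row nth_default. Qed.

Lemma cell_col_id x : (size s <= x)%N -> cell_col x = x.
Proof. by move=> sx; rewrite /cell_col nth_default. Qed.

Lemma cell_col_lt x : (x < size s)%N -> (cell_col x < size s)%N.
Proof. by move=> xs; have /and3P[_ /allP cs _] := sP; apply/cs/mem_nth. Qed.

Lemma mem_cell x : (x < size s)%N -> (cell_row x, cell_col x) \in s.
Proof. by move=> xs; rewrite -surjective_pairing mem_nth. Qed.

Lemma cell_inj x y : cell_row x = cell_row y -> cell_col x = cell_col y -> x = y.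
Proof.
have [xs|xs] := ltnP x (size s); have [ys|ys] := ltnP y (size s).
- move=> rxy cxy; have /and3P[us _ _] := sP; apply/eqP.
  rewrite -(nth_uniq (0%N, x) xs ys us); apply/eqP.
  rewrite [RHS](set_nth_default (0%N, y)) //.
  by rewrite [LHS]surjective_pairing [RHS]surjective_pairing; congr (_, _).
- by move=> _; rewrite (cell_col_id ys); have := cell_col_lt xs; lia.
- by move=> _; rewrite (cell_col_id xs); have := cell_col_lt ys; lia.
by move=> _; rewrite !cell_col_id.
Qed.

Lemma cell_diagram i j : (cell_row i < cell_row j)%N ->
  exists2 z, (z < size s)%N & cell_col z = cell_col j /\ cell_row z = cell_row i.
Proof.
move=> lt; have js : (j < size s)%N.
  by rewrite ltnNge; apply: contraTN lt => /cell_row0->.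
have /and3P[_ _ /allP ds] := sP.
have /(allP (ds _ (mem_cell js))) : cell_row i \in iota 0 (cell_row j).
  by rewrite mem_iota.
move=> zs; exists (index (cell_row i, cell_col j) s); first by rewrite index_mem.
by rewrite /cell_row /cell_col !nth_index.
Qed.

(** An entry added to the first row has weight 1 with the entries of lower rows. *)
Lemma total_weightE r : (size s <= r)%N ->
  total_weight r = (total_weight (size s) + (r - size s) * count (fun p => p.1 != 0) s)%N.
Proof.
move=> sr; rewrite -{1}(subnKC sr); move: (r - size s)%N => n {sr}.
elim: n => [|n IH]; first by rewrite addn0 mul0n addn0.
rewrite addnS /total_weight big_ord_recr /= -/(total_weight _) IH mulSn -addnA.
rewrite [(_ * _ + _)%N]addnC; congr (_ + (_ + _))%N.
rewrite big_split_ord /= [X in (_ + X)%N]big1 => [|i _]; last first.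
  by rewrite /cell_weight !cell_row0 ?leq_addr.
rewrite addn0 -sum1_count (big_nth (0%N, 0%N)) big_mkord [RHS]big_mkcond /=.
apply: eq_bigr => i _; rewrite /cell_weight (@cell_row0 (_ + n)) ?leq_addr //.
rewrite (cell_col_id (leq_addr n _)).
have ci : (cell_col i == size s + n)%N = false.
  by have := cell_col_lt (ltn_ord i); lia.
rewrite ci /cell_row (set_nth_default (0%N, 0%N)) //.
by case: (_ == 0%N).
Qed.

End Cells.

Section Tabloids.
Variables (F : fieldType) (r : nat) (lam : seq nat) (s : seq (nat * nat)).
Variable rho : nat -> nat.
Hypotheses (sP : is_diagram s) (sr : (size s <= r)%N).
Local Notation to := (tabloid_action r lam).

(** The image in the module of [lam] of the tabloid with row function [R]: an entry of
    a row other than row 0 has to lie in one of the rows that [rho] sends to it. *)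
Definition fits (R : 'I_r -> nat) (t : tabloid r lam) : F :=
  [forall x, (R x == 0)%N || (rho (val t x) == R x)]%:R.

Lemma eq_fits R1 R2 : R1 =1 R2 -> fits R1 =1 fits R2.
Proof. by move=> e t; rewrite /fits; congr (nat_of_bool _)%:R; apply: eq_forallb => x; rewrite e. Qed.

Lemma fits_act R g t : fits R (to t g) = fits (R \o g) t.
Proof.
congr (nat_of_bool _)%:R; apply/forallP/forallP=> h x; last by rewrite tabloid_actE -{1 3}(permKV g x) h.
by have := h (g x); rewrite tabloid_actE permK.
Qed.

Local Notation R := (fun x : 'I_r => cell_row s x).
Local Notation C := (fun x : 'I_r => cell_col s x).

Lemma ord_diagram (i j : 'I_r) : (R i < R j)%N -> exists2 z : 'I_r, C z = C j & R z = R i.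
Proof.
move=> /(cell_diagram sP)[z zs [zC zR]].
by exists (Ordinal (leq_trans zs sr)).
Qed.

(** If [g] is a column permutation with a nonzero term, every entry that it moves goes
    to row 0. Its image is moved as well, so it stays in row 0 and in its column,
    which have only one common cell. Hence [g] moves nothing. *)
Lemma antisymmetrize_fits (t : tabloid r lam) :
  (forall x : 'I_r, (x < size s)%N -> rho (val t x) = R x) ->
  antisymmetrize to C (fits R) t = 1.
Proof.
move=> tR; rewrite /antisymmetrize (bigD1 1%g); last first.
  by rewrite inE; apply/forallP=> x; rewrite perm1.
rewrite odd_perm1 expr0 mul1r act1 big1.
  rewrite [LHS]addr0 /fits; have -> // : [forall x, (R x == 0)%N || (rho (val t x) == R x)].
  apply/forallP=> x; have [xs|xs] := ltnP x (size s); first by rewrite tR // eqxx orbT.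
  by rewrite cell_row0.
move=> g /andP[]; rewrite inE => /forallP gC g1; rewrite fits_act /fits.
case: forallP => [h|]; last by rewrite mulr0.
have moved x : g x != x -> (x < size s)%N /\ cell_row s (g x) = 0%N.
  move=> gx; have xs : (x < size s)%N.
    rewrite ltnNge; apply: contra gx => xs; rewrite -val_eqE; apply/eqP.
    have := eqP (gC x); rewrite /= (cell_col_id xs).
    have [gs|gs] := ltnP (g x) (size s); last by rewrite cell_col_id.
    by have := cell_col_lt sP gs; lia.
  split=> //; have /orP[/eqP//|/= /eqP e] := h x.
  case/eqP: gx; apply/val_inj/(cell_inj sP); last exact: eqP (gC x).
  by rewrite -e tR.
case/eqP: g1; apply/permP=> x; rewrite perm1; apply/eqP/negPn/negP=> gx.
have [_ r1] := moved x gx; have ggx : g (g x) != g x by rewrite (inj_eq perm_inj).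
have [_ r2] := moved _ ggx; case/eqP: ggx; apply/val_inj/(cell_inj sP).
  by rewrite r1 r2.
exact: eqP (gC (g x)).
Qed.

Lemma tableau_nonprincipal (t : tabloid r lam) :
  (forall x : 'I_r, (x < size s)%N -> rho (val t x) = R x) ->
  (total_weight s r)%:R != 0 :> F ->
  has_nonprincipal_summand (young_perm_repr F r lam).
Proof.
move=> tR W0; pose phi := antisymmetrize to C (fits R).
apply: (@nonprincipal_of_eigen _ _ _ _ _ (transposition_sum F r) (vmx phi)
  (- (total_weight s r)%:R)).
- exact: transposition_sum_central.
- exact: transposition_sum_triv.
- by apply: (@vmx_neq0 _ _ _ t); rewrite /phi antisymmetrize_fits ?oner_eq0.
- by rewrite oppr_eq0.
rewrite transposition_sum_act scale_vmx; apply: eq_vmx => u.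
rewrite (antisymmetrize_eigen eq_fits fits_act ord_diagram); congr (- _%:R * _).
apply: eq_bigr => j _; rewrite (big_ord_widen_cond r xpredT (fun i => cell_weight s i j)) //.
exact: ltnW.
Qed.

End Tabloids.

Section Filling.

Lemma prefix_perm (X : eqType) (rho : X -> nat) (p : seq nat) (L : seq X) :
  (forall v, count_mem v p <= count (fun i => rho i == v) L)%N ->
  exists2 w, perm_eq w L & map rho (take (size p) w) = p.
Proof.
elim: p L => [|v p IH] L h; first by exists L; rewrite // take0.
have /hasP[i iL /eqP iv] : has (fun i => rho i == v) L.
  by rewrite has_count; apply: leq_trans (h v); rewrite /= eqxx.
have LE := perm_to_rem iL.
have [u|w wL wp] := IH (rem i L); last first.
  exists (i :: w); last by rewrite /= iv wp.
  by rewrite perm_sym (perm_trans LE) // perm_cons perm_sym.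
have := h u; rewrite (seq.permP LE) /= iv (eq_sym v u) => hu.
by move: hu; rewrite leq_add2l.
Qed.

Definition content (rho : nat -> nat) (lam : seq nat) v : nat :=
  \sum_(i < size lam | rho i == v) nth 0 lam i.

Lemma content_cons rho a l v :
  content rho (a :: l) v = ((rho 0%N == v) * a + content (rho \o succn) l v)%N.
Proof.
rewrite /content /= big_mkcond big_ord_recl /= -big_mkcond /=; congr (_ + _)%N.
by case: (_ == v); rewrite ?mul1n ?mul0n.
Qed.

Lemma content_const c l v : content (fun=> c) l v = ((c == v) * sumn l)%N.
Proof.
elim: l => [|a l IH]; first by rewrite /content big_ord0 muln0.
by rewrite content_cons [content _ l v]IH mulnDr.
Qed.

Lemma ex_tabloid_prefix r lam (rho : nat -> nat) (p : seq nat) : sumn lam = r ->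
  (forall v, count_mem v p <= content rho lam v)%N ->
  exists t : tabloid r lam, forall x : 'I_r, (x < size p)%N -> rho (val t x) = nth 0%N p x.
Proof.
move=> lr h; pose L := flatten [seq nseq (nth 0%N lam i) i | i : 'I_(size lam) <- enum 'I_(size lam)].
have countL (P : pred 'I_(size lam)) : count P L = (\sum_(i | P i) nth 0 lam i)%N.
  rewrite /L count_flatten -map_comp sumnE big_map big_enum [RHS]big_mkcond /=.
  by apply: eq_bigr => i _; rewrite /= count_nseq; case: (P i); rewrite ?mul1n ?mul0n.
have [|w wL wp] := @prefix_perm _ (fun i : 'I_(size lam) => rho i) p L.
  by move=> v; rewrite countL.
have sw : size w = r.
  rewrite (perm_size wL) -count_predT countL -lr sumnE (big_nth 0%N) big_mkord.
  exact: eq_bigl.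
have wr : size w == r by apply/eqP.
pose f : {ffun 'I_r -> 'I_(size lam)} := [ffun x => tnth (Tuple wr) x].
have fP : is_tabloid f.
  apply/forallP=> i; apply/eqP.
  transitivity (count (pred1 i) L); last by rewrite countL big_pred1_eq.
  have wE : w = map (tnth (Tuple wr)) (enum 'I_r) by rewrite map_tnth_enum.
  rewrite -(seq.permP wL) [w in RHS]wE count_map cardE size_filter.
  by rewrite -enumT; apply: eq_count => x; rewrite !inE /f ffunE.
exists (Sub f fP) => x xp; rewrite /= /f ffunE (tnth_nth (f x)) /=.
rewrite -[in RHS]wp.
have xs : (x < size (take (size p) w))%N by rewrite size_take_min leq_min xp sw ltn_ord.
by rewrite (nth_map (f x)) // nth_take.
Qed.

End Filling.

(** * The partitions (r), (r-2,1,1) and (1,1,1,1) *)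

Section Special.
Variable F : fieldType.

Lemma indecomposable_one_part r :
  indecomposable (young_perm_repr F r [:: r]) 1%:M.
Proof.
have [||t0 _] := @ex_tabloid_prefix r [:: r] id [::]; rewrite //= ?addn0 //.
apply: (indecomposable_kernel t0) => A _ AA.
have tt (t t' : tabloid r [:: r]) : t = t' by apply: tabloid_eqP => x; rewrite [LHS]ord1 [RHS]ord1.
have Aidem : A t0 t0 * A t0 t0 = A t0 t0.
  by rewrite -[RHS]AA (big_pred1 t0) // => u; rewrite (tt u t0) /= !eqxx.
have [A0|A0] := eqVneq (A t0 t0) 0; [left|right] => t t'; rewrite (tt t t0) (tt t' t0) //.
by rewrite eqxx; apply: (mulfI A0); rewrite Aidem mulr1.
Qed.

Lemma decomposable_of_nonprincipal r lam : sumn lam = r ->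
  has_nonprincipal_summand (young_perm_repr F r lam) ->
  decomposable (young_perm_repr F r lam) 1%:M.
Proof.
move=> lr; have [||t0 _] := @ex_tabloid_prefix r lam id [::]; rewrite //=.
exact: perm_nonprincipal_decomposable.
Qed.

(** Having the same last row is an equivalence relation with classes of size [r - 1].
    Its matrix multiplies the sum of all tabloids by [r - 1] and kills the difference
    of two tabloids of one class. *)
Lemma decomposable_two_singletons r a : (0 < a)%N -> (a + 2)%N = r ->
  (r - 1)%:R != 0 :> F -> decomposable (young_perm_repr F r [:: a; 1; 1]%N) 1%:M.
Proof.
move=> a0 ar r1; set lam := [:: a; 1%N; 1%N]; pose T := tabloid r lam.
have [||t0 t0P] := @ex_tabloid_prefix r lam id [:: 0; 1; 2]%N.
- by rewrite /= addn0.
- move=> v; rewrite /lam !content_cons /content big_ord0 /=.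
  by case: v => [|[|[|v]]] //=; rewrite ?muln1 ?mul0n ?mul1n; lia.
have r3 : (2 < r)%N by lia.
pose l2 : 'I_(size lam) := ord_max; pose l1 : 'I_(size lam) := Ordinal (isT : 1 < 3)%N.
pose agree (t t' : T) := [forall x, (val t x == l2) == (val t' x == l2)].
have agreeP (t t' : T) : reflect (forall x, (val t x == l2) = (val t' x == l2)) (agree t t').
  by apply: (iffP forallP) => h x; [exact: (eqP (h x)) | rewrite h].
have row0 (i j : 'I_(size lam)) : i != l1 -> i != l2 -> j != l1 -> j != l2 -> i = j.
  by case: i j => [[|[|[|//]]] ?] [[|[|[|//]]] ?] //= _ _ _ _; apply: val_inj.
pose act := tabloid_action r lam.
have eA : equivariant act act (fun t t' => (agree t t')%:R : F).
  move=> g t t'; congr (nat_of_bool _)%:R; apply/agreeP/agreeP=> h x.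
    by have := h (g x); rewrite !tabloid_actE !permK.
  by rewrite !tabloid_actE.
have card_agree t' : #|[set t | agree t t']| = (r - 1)%N.
  have [y yP] := @singleton_row _ _ t' l1 erefl; have [z zP] := @singleton_row _ _ t' l2 erefl.
  have yz : y != z by rewrite -zP; have := yP y; rewrite eqxx => /eqP->.
  (* The tabloid of the class of [t'] whose middle row is [x]. *)
  pose f x : T := act t' (tperm y x).
  have fE x u : val (f x) u = val t' (tperm y x u) by rewrite tabloid_actE tpermV.
  have -> : [set t | agree t t'] = f @: [set~ z].
    apply/setP=> t; rewrite inE; apply/agreeP/imsetP=> [tt'|[x]]; last first.
      rewrite !inE => xz -> u; rewrite fE !zP.
      by rewrite -{1}(tpermD yz xz) (inj_eq perm_inj).
    have [x xP] := @singleton_row _ _ t l1 erefl; exists x.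
      rewrite !inE -zP -tt'; have := xP x; rewrite eqxx => /eqP->//.
    apply: tabloid_eqP => u; rewrite fE.
    have tx : val t x = l1 by apply/eqP; rewrite xP.
    have ty : val t' y = l1 by apply/eqP; rewrite yP.
    have [->|ux] := eqVneq u x; first by rewrite tpermR tx ty.
    have xz : x != z by rewrite -zP -tt' tx.
    have [->|uz] := eqVneq u z.
      have /eqP -> : val t z == l2 by rewrite tt' zP.
      by rewrite tpermD //; apply/esym/eqP; rewrite zP.
    apply: row0; rewrite ?xP ?tt' ?zP //.
      by rewrite yP -[X in _ != X](tpermR y x) (inj_eq perm_inj).
    by rewrite -(tpermD yz xz) (inj_eq perm_inj).
  rewrite card_in_imset; first by rewrite cardsC1 card_ord subn1.
  move=> u v _ _ /(congr1 (fun t : T => val t v)); rewrite !fE tpermR.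
  have /eqP -> : val t' y == l1 by rewrite yP.
  by move/eqP; rewrite yP -[X in _ == X](tpermR y u) (inj_eq perm_inj) => /eqP->.
pose t1 : T := act t0 (tperm (Ordinal (ltnW (ltnW r3))) (Ordinal (ltnW r3))).
have t1E x : val t1 x = val t0 (tperm (Ordinal (ltnW (ltnW r3))) (Ordinal (ltnW r3)) x).
  by rewrite tabloid_actE tpermV.
have ag : agree t0 t1.
  apply/agreeP=> x; rewrite t1E; case: tpermP => [->|->|//];
  by rewrite -!val_eqE /= !t0P.
have t01 : t0 != t1.
  apply/eqP=> /(congr1 (fun t : T => val t (Ordinal (ltnW r3)))); rewrite t1E tpermR.
  by move/(congr1 val) => /=; rewrite !t0P.
apply: (@decomposable_kernel _ _ _ _ _ (fun t => (t == t0)%:R - (t == t1)%:R) (fun=> 1)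
  (r - 1)%:R t0 t0 eA) => //.
- by rewrite eqxx (negPf t01) subr0 oner_eq0.
- move=> t'; under eq_bigr do rewrite mulrBl.
  have pick u : \sum_t (t == u)%:R * (agree t t')%:R = (agree u t')%:R :> F.
    rewrite (bigD1 u) //= eqxx mul1r big1 ?addr0 // => v /negPf->.
    by rewrite mul0r.
  rewrite sumrB !pick; apply/eqP; rewrite subr_eq0; apply/eqP.
  congr (nat_of_bool _)%:R; have /agreeP at1 := ag.
  by apply/agreeP/agreeP=> h x; rewrite ?at1 // -at1.
- exact: oner_neq0.
move=> t'; rewrite mulr1 -(card_agree t') -sum1_card natr_sum [RHS]big_mkcond /=.
by apply: eq_bigr => t _; rewrite inE mul1r; case: (agree t t').
Qed.

(** With [s] the operator of [q], the endomorphism [1 + s + s ^ 2] multiplies the sum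
    of all tabloids by 3 and kills [t0 - s t0]. *)
Lemma decomposable_row_rotation r lam (q : 'I_(size lam) -> 'I_(size lam))
    (lam_q : forall j, (\sum_(i | q i == j) nth 0 lam i)%N = nth 0%N lam j)
    (t0 : tabloid r lam) :
  (forall i, q (q (q i)) = i) -> regroup lam_q t0 != t0 -> 3%:R != 0 :> F ->
  decomposable (young_perm_repr F r lam) 1%:M.
Proof.
move=> q3 qt0 n3; pose s : tabloid r lam -> tabloid r lam := regroup lam_q.
have s3 t : s (s (s t)) = t by apply: tabloid_eqP => x; rewrite !regroupE q3.
pose A (t t' : tabloid r lam) : F := (t == t')%:R + (t == s t')%:R + (t == s (s t'))%:R.
have eA : equivariant (tabloid_action r lam) (tabloid_action r lam) A.
  by move=> g t t'; rewrite /A /s !regroup_act !(inj_eq (@act_inj _ _ _ _ _)).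
have sum1 u : \sum_(t : tabloid r lam) (t == u)%:R = 1 :> F.
  rewrite (bigD1 u) //= eqxx big1 ?addr0 // => v /negPf->//.
have As t t' : A (s t) t' = A t t'.
  rewrite /A !(can2_eq (f := s) (g := fun t => s (s t))) //; try exact: s3.
  by rewrite !s3; ring.
apply: (@decomposable_kernel _ _ _ _ _ (fun t => (t == t0)%:R - (t == s t0)%:R) (fun=> 1)
  3%:R t0 t0 eA) => //.
- by rewrite eqxx [t0 == s t0]eq_sym (negPf qt0) subr0 oner_eq0.
- move=> t'; under eq_bigr do rewrite mulrBl.
  have pick u : \sum_t (t == u)%:R * A t t' = A u t'.
    rewrite (bigD1 u) //= eqxx mul1r big1 ?addr0 // => v /negPf->.
    by rewrite mul0r.
  by rewrite sumrB !pick As subrr.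
- exact: oner_neq0.
move=> t'; rewrite mulr1; under eq_bigr do rewrite mul1r.
by rewrite !big_split /= !sum1; ring.
Qed.

Lemma decomposable_four_singletons : 3%:R != 0 :> F ->
  decomposable (young_perm_repr F 4%N [:: 1; 1; 1; 1]%N) 1%:M.
Proof.
move=> n3; set lam := [:: 1; 1; 1; 1]%N.
pose q (i : 'I_(size lam)) : 'I_(size lam) := inord (nth 0 [:: 1; 2; 0; 3] i)%N.
have qE (i : 'I_(size lam)) : val (q i) = nth 0%N [:: 1; 2; 0; 3]%N i.
  by rewrite /q /= inordK //; case: i => [[|[|[|[|]]]]].
have q3 i : q (q (q i)) = i.
  by apply: val_inj; rewrite !qE; case: i => [[|[|[|[|]]]]].
have lam1 (i : 'I_(size lam)) : nth 0%N lam i = 1%N by case: i => [[|[|[|[|]]]]].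
have lam_q j : (\sum_(i | q i == j) nth 0 lam i)%N = nth 0%N lam j.
  rewrite (big_pred1 (q (q j))) ?lam1 // => i /=.
  by apply/eqP/eqP=> [<-|->]; rewrite q3.
have [||t0 t0P] := @ex_tabloid_prefix 4%N lam id [:: 0]%N => //.
  move=> v; rewrite /lam !content_cons /content big_ord0 /=.
  by case: v => [|v]; rewrite //=.
apply: (decomposable_row_rotation (lam_q := lam_q) (t0 := t0)) => //.
apply/eqP=> /(congr1 val)/ffunP/(_ ord0); rewrite regroupE => /(congr1 val).
by rewrite qE; have /= -> := t0P ord0 isT.
Qed.

End Special.

Section Zero.
Variables (F : fieldType) (r : nat).
Hypotheses (char2 : 2%N \in [pchar F]) (r2 : ~~ odd r).
Variable e : 'M[F]_#|[set: 'S_r]|.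
Hypotheses (Ie : central_idempotent e) (te : gring_op (triv_repr F [set: 'S_r]) e = 0).

(** The rows merge to the two-part composition [(a, 2)]. *)
Lemma two_singletons_kernel_zero a t t' : (1 < a)%N -> (a + 2)%N = r ->
  ring_kernel (tabloid_action r [:: a; 1; 1]%N) e t t' = 0.
Proof.
move=> a1 ar; pose q (i : 'I_3) : 'I_2 := inord (i - (1 < i)).
have qE i : val (q i) = (i - (1 < i))%N by rewrite /q /= inordK //; have := ltn_ord i; lia.
apply: (@merge_adjacent_kernel_zero F r char2 [:: a; 1; 1]%N [:: a; 2]%N q 1) => //.
  move=> m; rewrite big_mkcond !big_ord_recl big_ord0 -!val_eqE /= !inordK //.
  by case: m => [[|[|//]] ?] /=; rewrite ?addn0.
move=> u u'; apply: (two_part_kernel_zero char2) => //; lia.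
Qed.

(** The rows merge first to [(1, 1, 2)] and then to [(2, 2)]. *)
Lemma four_singletons_kernel_zero t t' : r = 4%N ->
  ring_kernel (tabloid_action r [:: 1; 1; 1; 1]%N) e t t' = 0.
Proof.
move=> r4.
have zero112 u u' : ring_kernel (tabloid_action r [:: 1; 1; 2]%N) e u u' = 0.
  pose q (i : 'I_3) : 'I_2 := inord (i - (0 < i)).
  have qE i : val (q i) = (i - (0 < i))%N by rewrite /q /= inordK //; have := ltn_ord i; lia.
  apply: (@merge_adjacent_kernel_zero F r char2 [:: 1; 1; 2]%N [:: 2; 2]%N q 0) => //.
    move=> m; rewrite big_mkcond !big_ord_recl big_ord0 -!val_eqE /= !inordK //.
    by case: m => [[|[|//]] ?].
  by move=> v v'; apply: (two_part_kernel_zero char2) => //; rewrite r4.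
pose q (i : 'I_4) : 'I_3 := inord (i - (2 < i)).
have qE i : val (q i) = (i - (2 < i))%N by rewrite /q /= inordK //; have := ltn_ord i; lia.
apply: (@merge_adjacent_kernel_zero F r char2 [:: 1; 1; 1; 1]%N [:: 1; 1; 2]%N q 2) => //.
move=> m; rewrite big_mkcond !big_ord_recl big_ord0 -!val_eqE /= !inordK //.
by case: m => [[|[|[|//]]] ?].
Qed.

End Zero.

(** * Nonprincipal summands *)

Section Partitions.
Local Open Scope nat_scope.

Lemma partition_cases r lam : 0 < r -> is_partition r lam ->
  [\/ lam = [:: r],
      exists a k, [/\ lam = [:: a; k], 0 < k, k <= a & a + k = r]
    | exists a b c l, [/\ lam = [:: a, b, c & l], 0 < c, c <= b <= a,
                          all (fun d => 0 < d <= c) l & a + (b + (c + sumn l)) = r]].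
Proof.
move=> r0 /and3P[].
case: lam => [|a [|b [|c l]]] /=; first by move=> _ _ /eqP e; rewrite -e in r0.
- by move=> _ _ /eqP; rewrite addn0 => ->; constructor 1.
- rewrite !andbT addn0 => ba /andP[a0 b0] /eqP ab; constructor 2.
  by exists a, b; split.
move=> /and3P[ba cb pl] /and4P[a0 b0 c0 l0] /eqP abc; constructor 3.
exists a, b, c, l; split=> //; first by rewrite cb ba.
have gtr : transitive geq by move=> x y z xy yx; apply: leq_trans yx xy.
have := order_path_min gtr pl => lc.
by apply/allP=> d dl; rewrite (allP l0 _ dl); apply: (allP lc _ dl).
Qed.

Lemma all_pos_sumn c l : all (fun d => 0 < d <= c) l -> sumn l = 0 -> l = [::].
Proof. by case: l => [//|d l] /= /andP[/andP[d0 _] _]; lia. Qed.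

Lemma dvdn_pow2_bit i c : ~~ (2 ^ i %| c) ->
  exists2 d, d < i & odd (c %/ 2 ^ d).
Proof.
move=> nic; have c0 : 0 < c by case: c nic; rewrite ?dvdn0.
have [m m2 cE] := pfactor_coprime (isT : prime 2) c0.
exists (logn 2 c); last by rewrite {1}cE mulnK ?expn_gt0 // -coprime2n.
by rewrite ltnNge -pfactor_dvdn.
Qed.

End Partitions.

Section Nonprincipal.
Variable F : fieldType.

(** The cells of the shapes [(r-1,1)], [(r-2,2)] and [(r-3,2,1)] up to the end of the
    last column of length at least 2. *)
Definition column2 : seq (nat * nat) := [:: (0, 0); (1, 0)]%N.
Definition square : seq (nat * nat) := [:: (0, 0); (1, 0); (0, 1); (1, 1)]%N.
Definition staircase : seq (nat * nat) := [:: (0, 0); (1, 0); (2, 0); (0, 1); (1, 1)]%N.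

Lemma weight_column2 r : (2 <= r)%N -> total_weight column2 r = r.
Proof.
move=> r2; rewrite total_weightE //=.
by rewrite /total_weight !big_ord_recr !big_ord0 /cell_weight /=; lia.
Qed.

Lemma weight_square r : (4 <= r)%N -> total_weight square r = (r + r - 2)%N.
Proof.
move=> r2; rewrite total_weightE //=.
by rewrite /total_weight !big_ord_recr !big_ord0 /cell_weight /=; lia.
Qed.

Lemma weight_staircase r : (5 <= r)%N -> total_weight staircase r = (3 * r - 3)%N.
Proof.
move=> r2; rewrite total_weightE //=.
by rewrite /total_weight !big_ord_recr !big_ord0 /cell_weight /=; lia.
Qed.

(** It suffices to group the rows of [lam] by [rho] so that each group is at least as
    large as the part of the corresponding row among the cells [s]. *)
Lemma tableau_content_nonprincipal r lam s rho : is_diagram s -> (size s <= r)%N ->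
  sumn lam = r ->
  (forall v, count_mem v (map fst s) <= content rho lam v)%N ->
  (total_weight s r)%:R != 0 :> F ->
  has_nonprincipal_summand (young_perm_repr F r lam).
Proof.
move=> sP sr lr h W0; have [t tP] := ex_tabloid_prefix lr h.
apply: (tableau_nonprincipal (rho := rho) (s := s) sP sr (t := t)) => // x xs.
rewrite tP ?size_map // (nth_map (0%N, x : nat)) //.
Qed.

Lemma nonprincipal_column2 r a b l : (0 < a)%N -> (0 < b)%N ->
  (a + (b + sumn l))%N = r -> r%:R != 0 :> F ->
  has_nonprincipal_summand (young_perm_repr F r [:: a, b & l]).
Proof.
move=> a0 b0 abl r0.
have sr : (size column2 <= r)%N by rewrite /=; lia.
apply: (@tableau_content_nonprincipal r _ column2 (fun i => (i == 0)%N : nat)) => //.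
  move=> v; rewrite !content_cons /= [content _ l v](content_const 0).
  by case: v => [|[|v]] //=; lia.
by rewrite weight_column2.
Qed.

Lemma nonprincipal_square r lam : (3 < r)%N -> is_partition r lam ->
  lam <> [:: r] -> lam <> [:: r - 1; 1]%N -> r%:R = 0 :> F -> 2%:R != 0 :> F ->
  has_nonprincipal_summand (young_perm_repr F r lam).
Proof.
move=> r3 lamP lr lr1 r0 n2.
have weight : (total_weight square r)%:R != 0 :> F.
  rewrite weight_square // natrB ?natrD ?r0; last lia.
  by rewrite addr0 sub0r oppr_eq0.
have /and3P[_ _ /eqP sl] := lamP.
have [//|[a [k [lamE k0 ka akr]]]|[a [b [c [l [lamE c0 /andP[cb ba] lc abc]]]]]] :=
  partition_cases (ltnW (ltnW (ltnW r3))) lamP.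
  apply: (@tableau_content_nonprincipal r _ square (fun i => (i == 0)%N : nat)) => // v.
  have k1 : k <> 1%N by move=> k1; apply: lr1; rewrite lamE -akr k1 addnK.
  rewrite lamE !content_cons /content big_ord0 /=.
  by case: v => [|[|v]] //=; lia.
(* If all rows are singletons, two of them play the role of a row of length 2. *)
have [a1|a1] := ltnP 1 a.
  apply: (@tableau_content_nonprincipal r _ square (fun i => (i == 0)%N : nat)) => // v.
  rewrite lamE !content_cons /= [content _ l v](content_const 0).
  by case: v => [|[|v]] //=; lia.
apply: (@tableau_content_nonprincipal r _ square (fun i => (i < 2)%N : nat)) => // v.
rewrite lamE !content_cons /= [content _ l v](content_const 0).
by case: v => [|[|v]] //=; lia.
Qed.

Lemma nonprincipal_staircase r a b c l : 2%N \in [pchar F] -> ~~ odd r -> (5 < r)%N ->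
  (0 < c)%N -> (c <= b <= a)%N -> all (fun d => 0 < d <= c)%N l ->
  (a + (b + (c + sumn l)))%N = r -> [:: a, b, c & l] <> [:: r - 2; 1; 1]%N ->
  has_nonprincipal_summand (young_perm_repr F r [:: a, b, c & l]).
Proof.
move=> char2 r2 r5 c0 /andP[cb ba] lc abc not_excl.
have weight : (total_weight staircase r)%:R != 0 :> F.
  rewrite weight_staircase; last lia.
  rewrite (natr_odd char2); set u := odd _; have -> : u = true by rewrite /u; lia.
  exact: oner_neq0.
have sl : sumn [:: a, b, c & l] = r by rewrite /= abc.
have sr : (size staircase <= r)%N by apply: ltnW.
(* The tableau needs one entry in row 2 and two in row 0. If there are just three
   parts the last may be 1, so it goes to row 2 and the second one to row 0. *)
case: l => [|d l] in lc abc not_excl sl *; rewrite /= in lc abc.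
  have b1 : (1 < b)%N.
    rewrite ltnNge; apply/negP=> b1; apply: not_excl.
    have -> : b = 1%N by lia.
    have -> : c = 1%N by lia.
    by congr [:: _; _; _]; lia.
  apply: (@tableau_content_nonprincipal r _ staircase (nth 0%N [:: 1; 0; 2]%N)) => // v.
  rewrite !content_cons /content big_ord0 /=.
  by case: v => [|[|[|v]]] //=; lia.
case/andP: lc => /andP[d0 dc] lc.
have [a1|a1] := ltnP 1 a.
  apply: (@tableau_content_nonprincipal r _ staircase (nth 0%N [:: 1; 2]%N)) => // v.
  rewrite !content_cons.
  by case: v => [|[|[|v]]] //=; lia.
apply: (@tableau_content_nonprincipal r _ staircase (nth 0%N [:: 1; 1; 2]%N)) => // v.
rewrite !content_cons (_ : content _ l v = content (fun=> 0%N) l v); last first.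
  by apply: eq_bigl => i /=; rewrite ?nth_nil.
rewrite content_const.
by case: v => [|[|[|v]]] //=; lia.
Qed.

End Nonprincipal.

(** * The classification *)

Section TwoPartCriterion.
Local Open Scope nat_scope.

(** Both conditions say that [2 ^ i] divides [r - 2 * k], where [2 ^ i] is the least
    power of 2 above [k]. *)
Lemma two_part_congruence r k n i : ~~ odd r -> k + k <= r ->
  2 ^ n <= r < 2 ^ n.+1 -> 0 < i <= n ->
  (k == (r - 2 ^ n) %/ 2 %[mod 2 ^ (i - 1)]) = (2 ^ i %| r - (k + k)).
Proof.
case: i => // i r2 kr /andP[nr rn] /= i_n; rewrite subn1 /=.
case: n => // n in nr rn i_n *.
have [h hE] : exists h, r = h + h + 2 ^ n.+1.
  by exists (r./2 - 2 ^ n); rewrite expnS in nr *; lia.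
have [m mE] : exists m, r = k + k + (m + m) by exists (r./2 - k); lia.
have -> : (r - 2 ^ n.+1) %/ 2 = h by rewrite hE; lia.
have -> : r - (k + k) = 2 * m by rewrite mE; lia.
have hk : k + m = h + 2 ^ n by rewrite expnS in hE; lia.
rewrite expnS dvdn_pmul2l //.
have dn : 2 ^ i %| 2 ^ n by rewrite dvdn_exp2l.
have -> : (k == h %[mod 2 ^ i]) = (k + 0 == k + m %[mod 2 ^ i]).
  by rewrite hk -(modnDmr h) (eqP dn) !addn0.
by rewrite eqn_modDl mod0n eq_sym.
Qed.

End TwoPartCriterion.

Lemma indecomposableN (F : fieldType) r lam :
  indecomposable (young_perm_repr F r lam) 1%:M ->
  ~ decomposable (young_perm_repr F r lam) 1%:M.
Proof. by case. Qed.

Section Main.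
Variables (F : fieldType) (r : nat) (lam : seq nat).
Hypotheses (r0 : (0 < r)%N) (lamP : is_partition r lam).
Local Notation M := (young_perm_repr F r lam).

Let lam_sum : sumn lam = r. Proof. by case/and3P: lamP => _ _ /eqP. Qed.

Lemma indecomposable_standard : lam = [:: r - 1; 1]%N -> r%:R = 0 :> F ->
  indecomposable M 1%:M.
Proof.
move=> lamE rF; have r1 : (0 < r - 1)%N.
  by have := lamP; rewrite lamE /is_partition /= andbT => /and3P[].
by rewrite lamE; apply: natural_indecomposable => //; rewrite subnK.
Qed.

Lemma nonprincipal_not_dvd : lam <> [:: r] -> r%:R != 0 :> F -> has_nonprincipal_summand M.
Proof.
move=> lr rF.
have [//|[a [k [lamE k0 ka akr]]]|[a [b [c [l [lamE c0 /andP[cb ba] lc abc]]]]]] :=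
  partition_cases r0 lamP.
  by rewrite lamE; apply: nonprincipal_column2; rewrite /= ?addn0 //; lia.
by rewrite lamE; apply: nonprincipal_column2 => //; lia.
Qed.

Section OddCharacteristic.
Variable p : nat.
Hypotheses (pF : p \in [pchar F]) (p2 : odd p).

Let two_neq0 : 2%:R != 0 :> F.
Proof.
rewrite -(dvdn_pcharf pF); apply/negP=> /dvdn_leq => /(_ isT).
by have := prime_gt1 (pcharf_prime pF); have := p2; case: p => [|[|[|?]]].
Qed.

Lemma odd_small : (p %| r)%N -> (r <= 3)%N -> p = 3%N /\ r = 3%N.
Proof.
move=> /(dvdn_leq r0) pr r3.
by have := prime_gt1 (pcharf_prime pF); have := p2; lia.
Qed.

Lemma odd_nonprincipal : (p %| r)%N -> lam <> [:: r] -> lam <> [:: r - 1; 1]%N ->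
  ~ (p = 3%N /\ r = 3%N) -> has_nonprincipal_summand M.
Proof.
move=> pr lr lr1 pr3; have r3 : (3 < r)%N.
  by rewrite ltnNge; apply/negP=> /(odd_small pr).
by apply: nonprincipal_square => //; apply/eqP; rewrite -(dvdn_pcharf pF).
Qed.

(** The exceptional case [p = r = 3] leaves the regular module of ['S_3], where the
    whole group algebra is the principal block. *)
Lemma odd_decomposable : (p %| r)%N -> lam <> [:: r] -> lam <> [:: r - 1; 1]%N ->
  decomposable M 1%:M.
Proof.
move=> pr lr lr1; have [r3|r3] := ltnP 3 r.
  by apply/decomposable_of_nonprincipal/odd_nonprincipal => //; lia.
have [_ rE] := odd_small pr r3.
have [//|[a [k [lamE k0 ka akr]]]|[a [b [c [l [lamE c0 /andP[cb ba] lc abc]]]]]] :=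
  partition_cases r0 lamP.
  by case: lr1; rewrite lamE; congr [:: _; _]; lia.
have sl : sumn l = 0%N by lia.
have lE : lam = [:: 1; 1; 1]%N.
  by rewrite lamE (all_pos_sumn lc sl); congr [:: _; _; _]; lia.
by rewrite lE; apply: decomposable_two_singletons; rewrite ?rE //; apply: two_neq0.
Qed.

Lemma odd_indecomposable_iff :
  indecomposable M 1%:M <->
    ((p %| r)%N /\ (lam = [:: r] \/ lam = [:: r - 1; 1]%N)) \/ (~~ (p %| r)%N /\ lam = [:: r]).
Proof.
split=> [Mind|[[pr [lr|lr]]|[_ lr]]].
- have [lr|lr] := eqVneq lam [:: r].
    by case: (boolP (p %| r)%N) => pr; [left; split; [|left]|right].
  case: (boolP (p %| r)%N) => pr; last first.
    case: (indecomposableN Mind); apply/decomposable_of_nonprincipal/nonprincipal_not_dvd => //.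
      exact/eqP.
    by rewrite -(dvdn_pcharf pF).
  left; split=> //; right; apply/eqP; apply: contra_notT (indecomposableN Mind) => /eqP lr1.
  by apply: odd_decomposable => //; apply/eqP.
- by rewrite lr; apply: indecomposable_one_part.
- by apply: indecomposable_standard => //; apply/eqP; rewrite -(dvdn_pcharf pF).
by rewrite lr; apply: indecomposable_one_part.
Qed.

Lemma odd_decomposable_nonprincipal : ~ (p = 3%N /\ r = 3%N) ->
  decomposable M 1%:M -> has_nonprincipal_summand M.
Proof.
move=> pr3 Mdec.
have lr : lam <> [:: r].
  by move=> lr; move: Mdec; rewrite lr; apply/indecomposableN/indecomposable_one_part.
case: (boolP (p %| r)%N) => pr; last first.
  by apply: nonprincipal_not_dvd => //; rewrite -(dvdn_pcharf pF).
apply: odd_nonprincipal => // lr1; case: (indecomposableN _ Mdec).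
by apply: indecomposable_standard => //; apply/eqP; rewrite -(dvdn_pcharf pF).
Qed.

End OddCharacteristic.

Section EvenCharacteristic.
Hypothesis char2 : 2%N \in [pchar F].

Let odd_neq0 n : odd n -> n%:R != 0 :> F.
Proof. by move=> n2; rewrite (natr_odd char2) n2 oner_neq0. Qed.

Lemma odd_degree_indecomposable_iff : odd r -> indecomposable M 1%:M <-> lam = [:: r].
Proof.
move=> r2; split=> [Mind|->]; last exact: indecomposable_one_part.
apply/eqP; apply: contra_notT (indecomposableN Mind) => /eqP lr.
by apply/decomposable_of_nonprincipal/nonprincipal_not_dvd/odd_neq0.
Qed.

Hypothesis r2 : ~~ odd r.

(** For [r <= 4] the partitions with three parts are [(2, 1, 1)] and [(1, 1, 1, 1)]. *)
Lemma even_three_parts a b c l : lam = [:: a, b, c & l] ->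
  (0 < c)%N -> (c <= b <= a)%N -> all (fun d => 0 < d <= c)%N l ->
  (a + (b + (c + sumn l)))%N = r ->
  [\/ (5 < r)%N /\ lam <> [:: r - 2; 1; 1]%N, lam = [:: r - 2; 1; 1]%N
    | r = 4%N /\ lam = [:: 1; 1; 1; 1]%N].
Proof.
move=> lamE c0 cba lc abc.
have [->|/eqP lr] := eqVneq lam [:: r - 2; 1; 1]%N; first by constructor 2.
have [r5|r5] := ltnP 5 r; first by constructor 1.
have r4 : r = 4%N by lia.
case: l => [|d l] in lamE lc abc *.
  by case: lr; rewrite lamE; rewrite /= in abc; congr [:: _; _; _]; lia.
case/andP: lc => d0 lc; rewrite /= in abc.
have sl : sumn l = 0%N by lia.
constructor 3; split=> //; rewrite lamE (all_pos_sumn lc sl).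
by congr [:: _; _; _; _]; lia.
Qed.

Lemma even_three_parts_decomposable a b c l : lam = [:: a, b, c & l] ->
  (0 < c)%N -> (c <= b <= a)%N -> all (fun d => 0 < d <= c)%N l ->
  (a + (b + (c + sumn l)))%N = r -> decomposable M 1%:M.
Proof.
move=> lamE c0 cba lc abc.
case: (even_three_parts lamE c0 cba lc abc) => [[r5 lr]|lE|[r4 lE]].
- apply: decomposable_of_nonprincipal => //.
  by rewrite lamE; apply: nonprincipal_staircase; rewrite // -lamE.
- by rewrite lE; apply: decomposable_two_singletons; [lia|lia|apply: odd_neq0; lia].
by rewrite lE r4; apply: decomposable_four_singletons; apply: odd_neq0.
Qed.

Lemma even_indecomposable_iff :
  indecomposable M 1%:M <->
  lam = [:: r] \/ exists n i ki : nat,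
    [/\ (2 ^ n <= r < 2 ^ n.+1)%N, (1 <= i <= n)%N, (2 ^ (i - 1) <= ki < 2 ^ i)%N,
        ki = ((r - 2 ^ n) %/ 2)%N %[mod 2 ^ (i - 1)] & lam = [:: r - ki; ki]%N].
Proof.
split=> [Mind|[->|[n [i [k [nr i_n /andP[ik ki] kmod lamE]]]]]].
- have [lr|[a [k [lamE k0 ka akr]]]|[a [b [c [l [lamE c0 cba lc abc]]]]]] :=
    partition_cases r0 lamP; first by left.
    right; set n := trunc_log 2 r; set i := (trunc_log 2 k).+1.
    have nr : (2 ^ n <= r < 2 ^ n.+1)%N by apply: trunc_log_bounds.
    have /andP[ik ki] : (2 ^ trunc_log 2 k <= k < 2 ^ i)%N by apply: trunc_log_bounds.
    have kr : (k + k <= r)%N by lia.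
    have i_n : (0 < i <= n)%N.
      apply/andP; split=> //; rewrite -ltnS -(@ltn_exp2l 2) //; case/andP: nr => _ rn.
      apply: leq_ltn_trans rn.
      by rewrite /i expnS; lia.
    exists n, i, k; split=> //.
    + by rewrite subn1 ik ki.
    + apply/eqP; rewrite two_part_congruence //.
      apply: contra_notT (indecomposableN Mind) => /dvdn_pow2_bit[d di od].
      rewrite lamE; apply: (two_part_decomposable akr char2 kr _ od).
      by apply: leq_trans ik; rewrite leq_exp2l.
    by rewrite lamE -akr addnK.
  by case: (indecomposableN Mind); apply: even_three_parts_decomposable lamE c0 cba lc abc.
- exact: indecomposable_one_part.
have [k1 kr] : (k <= r - k /\ 0 < k)%N.
  by have := lamP; rewrite lamE /is_partition /= !andbT => /and3P[? /andP[_ ?] _].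
have kkr : (k + k <= r)%N by lia.
rewrite lamE; apply: (two_part_indecomposable _ char2 kkr ki); first lia.
by rewrite -(two_part_congruence r2 kkr nr i_n); apply/eqP.
Qed.

Lemma even_nonprincipal_iff :
  has_nonprincipal_summand M <->
  [/\ (3 <= size lam)%N, (6 <= r)%N & lam <> [:: r - 2; 1; 1]%N].
Proof.
have [lr|[a [k [lamE k0 ka akr]]]|[a [b [c [l [lamE c0 cba lc abc]]]]]] :=
  partition_cases r0 lamP.
- split=> [/(decomposable_of_nonprincipal lam_sum)|[]]; last by rewrite lr.
  by rewrite lr => /(indecomposableN (indecomposable_one_part F r)).
- split=> [|[]]; last by rewrite lamE.
  rewrite lamE => /nonprincipal_zero[] // e t t' Ie te.
  by apply: (two_part_kernel_zero char2) => //; lia.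
split=> [Mnp|[_ r6 lr]]; last first.
  by rewrite lamE; apply: nonprincipal_staircase; rewrite // -lamE.
case: (even_three_parts lamE c0 cba lc abc) => [[r5 lr]|lE|[r4 lE]].
- by rewrite {1}lamE.
- case: (nonprincipal_zero _ Mnp) => e t t' Ie te; move: t t'; rewrite lE => t t'.
  by apply: two_singletons_kernel_zero => //; have := lam_sum; rewrite lE /=; lia.
case: (nonprincipal_zero _ Mnp) => e t t' Ie te; move: t t'; rewrite lE => t t'.
exact: four_singletons_kernel_zero.
Qed.

End EvenCharacteristic.
End Main.

Theorem theorem2 (k : fieldType) (p : nat) (r : nat) (lam : seq nat)
    (hp : p \in [pchar k]) (hr : (0 < r)%N) (hlam : is_partition r lam) :
  (odd p ->
     (indecomposable (young_perm_repr k r lam) 1%:M <->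
        ((p %| r)%N /\ (lam = [:: r] \/ lam = [:: (r - 1)%N; 1%N]))
        \/ (~~ (p %| r)%N /\ lam = [:: r])))
  /\
  (p = 2%N ->
     (indecomposable (young_perm_repr k r lam) 1%:M <->
        (odd r /\ lam = [:: r])
        \/ (~~ odd r /\
              (lam = [:: r] \/
               exists n i ki : nat,
                 [/\ (2 ^ n <= r < 2 ^ n.+1)%N,
                     (1 <= i <= n)%N,
                     (2 ^ (i - 1) <= ki < 2 ^ i)%N,
                     ki = ((r - 2 ^ n) %/ 2)%N %[mod 2 ^ (i - 1)]
                   & lam = [:: (r - ki)%N; ki]]))))
  /\
  ((odd p /\ ~ (p = 3%N /\ r = 3%N)) \/ (p = 2%N /\ odd r) ->
     (decomposable (young_perm_repr k r lam) 1%:M <->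
        has_nonprincipal_summand (young_perm_repr k r lam)))
  /\
  (p = 2%N -> ~~ odd r ->
     (has_nonprincipal_summand (young_perm_repr k r lam) <->
        [/\ (3 <= size lam)%N, (6 <= r)%N & lam <> [:: (r - 2)%N; 1%N; 1%N]])).
Proof.
have lam_sum : sumn lam = r by case/and3P: hlam => _ _ /eqP.
have char2 : p = 2%N -> 2%N \in [pchar k] by move=> p2; rewrite -p2.
split; first exact: odd_indecomposable_iff.
split.
  move=> /char2 {}char2; case: (boolP (odd r)) => r2.
    rewrite (odd_degree_indecomposable_iff hr hlam char2 r2).
    by split=> [lr|[[]|[]]]; [left|..].
  rewrite (even_indecomposable_iff hr hlam char2 r2).
  by split=> [lr|[[]|[]]]; [right|..].
split; last by move=> /char2 {}char2; apply: even_nonprincipal_iff.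
move=> cases; split; last exact: decomposable_of_nonprincipal.
case: cases => [[p2 pr3]|[/char2 {}char2 r2]].
  exact: (odd_decomposable_nonprincipal hr hlam hp p2 pr3).
move=> Mdec; apply: nonprincipal_not_dvd => //; last first.
  by rewrite (natr_odd char2) r2 oner_eq0.
move/(odd_degree_indecomposable_iff hr hlam char2 r2); exact: (fun h => indecomposableN h Mdec).
Qed.
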